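(* There exist absolute constants $c_0,C_0>0$ such that the following holds. Assume $n^{-0.49}\le\epsilon\le c_0$ and $W\ge n^{C_0}$. Then any randomized turnstile streaming algorithm that, on every unit update turnstile stream on $\mathbb Z^n$ of length at most $W$, outputs a $(1+\epsilon)$-approximation to the $L_0$ norm of the final frequency vector with success probability at least $2/3$ must use $\Omega\left(\frac{\epsilon^{-2}\log n\,\log\log W}{\log(\epsilon^{-2}\log n\,\log\log W)}\right)$ bits of space. Furthermore, if $W\ge(\epsilon^{-2}\log n)^{C_0\epsilon^{-2}\log n}$, then the algorithm must use $\Omega(\epsilon^{-2}\log n\cdot\log\log W)$ bits of space.
   Context: The $L_0$ norm $\|x\|_0$ is the number of nonzero coordinates of $x$; a $(1+\epsilon)$-approximation is a value $z$ with $(1-\epsilon)\|x\|_0\le z\le(1+\epsilon)\|x\|_0$. A unit update turnstile stream is a sequence of updates $(i,\Delta)$, $i\in[n]$, $\Delta\in\{\pm1\}$, each adding $\Delta$ to coordinate $i$ of a vector starting at $0$. A randomized streaming algorithm using $S$ bits is a public-coin family of deterministic streaming algorithms each with at most $2^S$ memory states; the seed is not counted toward the space and success probability is over the seed for each fixed stream. *)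

(* Defs.v *)
From HB Require Import structures.
From mathcomp Require Import all_boot all_order all_algebra.
From mathcomp Require Import all_classical all_reals all_analysis.

Set Implicit Arguments.
Unset Strict Implicit.
Unset Printing Implicit Defensive.

Import Order.TTheory GRing.Theory Num.Theory.
Local Open Scope ring_scope.

Definition update (n : nat) : Type := ('I_n * int)%type.

Definition stream (n : nat) : Type := seq (update n).

Definition unit_update_stream (n : nat) (s : stream n) : Prop :=
  all (fun u : update n => (u.2 == 1) || (u.2 == -1)) s.

Definition frequency_vector (n : nat) (s : stream n) : 'rV[int]_n :=
  \sum_(u <- s) u.2 *: delta_mx 0 u.1.

Definition L0norm (n : nat) (x : 'rV[int]_n) : nat :=
  #|[set i : 'I_n | x ord0 i != 0]|%SET.

Definition approximates (R : realType) (n : nat) (eps : R) (x : 'rV[int]_n)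
    (z : R) : Prop :=
  (1 - eps) * (L0norm x)%:R <= z /\ z <= (1 + eps) * (L0norm x)%:R.

Record det_algorithm (R : realType) (n : nat) := DetAlgorithm {
  memory : finType;
  initial : memory;
  process : memory -> update n -> memory;
  answer : memory -> R }.

Definition output (R : realType) (n : nat) (A : det_algorithm R n)
    (s : stream n) : R :=
  answer (foldl (@process R n A) (@initial R n A) s).

Section RandomizedAlgorithm.
Context (R : realType) (d : measure_display) (Seed : measurableType d).
Variables (P : probability Seed R) (n : nat) (A : Seed -> det_algorithm R n).

Definition uses_space (S : nat) : Prop :=
  forall w : Seed, (#|memory (A w)| <= 2 ^ S)%N.

Definition success_event (eps : R) (s : stream n) : set Seed :=
  [set w | approximates eps (frequency_vector s) (output (A w) s)]%classic.

(* The measure of a non-measurable set carries no meaning, so measurability of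
   the success event is part of "succeeds with probability at least 2/3"; no
   other measurability is required of the family A. *)
Definition approximates_L0 (eps : R) (W : nat) : Prop :=
  forall s : stream n, unit_update_stream s -> (size s <= W)%N ->
    measurable (success_event eps s) /\
    ((2 / 3 : R)%:E <= P (success_event eps s))%E.

End RandomizedAlgorithm.

(* Main.v *)
Require Import Defs.
From HB Require Import structures.
From mathcomp Require Import all_boot all_order all_algebra all_fingroup.
From mathcomp Require Import all_classical all_reals all_analysis.
From mathcomp Require Import measurable_realfun ring lra zify.

Set Implicit Arguments.
Unset Strict Implicit.
Unset Printing Implicit Defensive.

Import Order.TTheory GRing.Theory Num.Theory.
Local Open Scope ring_scope.

                                                                                
                                                                                       
                                                                                    
                                                                                 
                                                                                    
                                                                                      
                                                                                    
                                                                 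

                                                                                     
                                                                                       
                                                                         
                                                                                       
                                                                                       
                                                                                
                                                                             
                                                                                        
                                                                                     
                                                                                   
                                                                                    
                    

                                   

(** The algorithm is turned into a one-way protocol. Some coordinates are grouped into [L] levels of
    [k] blocks, a block of level [l] having [2 ^ l] coordinates; here [k] is of order eps^-2 and [L]
    of order ln n. Alice streams a positive multiplicity for every block. Bob deletes all blocks
    above a level [ell], leaves those below it untouched, and for a set [J] of blocks of level [ell]
    deletes the multiplicity that he would expect if Alice's hidden bits [b] were his own random
    bits [y]. The levels below weigh less than [k * 2 ^ ell], so the L0 norm is a constant minus
    [2 ^ ell * corr J b y / 2] ([L0norm_protocol]), and precision eps resolves deviations of order
    sqrt k. Correct answers therefore force the conditional means of the signs of [b] on [J], given
    the message, to have squares summing to at least [#|J| / 1600] ([correlation_bias],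
    [protocol_bias]). An averaging argument fixes one good seed for a whole family of such protocols
    ([hard_distribution], [protocol_family]).

    Short streams: the multiplicities are [1 + b]. Bias is bounded by information
    ([bit_information]), information adds up by the chain rule to at most S ln 2, and S is at least
    of order [L * k], that is eps^-2 ln n ([short_stream_bound]).

    Long streams gain the factor ln ln W. The multiplicities are now large, random and independent
    of [b]; Bob is told the totals plus [Lm! * b]. Bits stay hidden as long as the final state
    cannot tell a total from the same total shifted by [Lm!]. To show this, totals are built in
    [tau] rounds of two phases, and of the examined block only the sum over both phases is
    disclosed. An energy potential shows that in a typical round the law of the final state hardly
    depends on more than this sum ([sum_forgetting]). If one middle state is reached from two
    first-phase counts at distance d <= [Lm], that law is nearly d-periodic in the sum; it is also
    nearly periodic with some period at most M = 2^S, because repeating a block drives a finite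
    automaton into a cycle. Together these give approximate period [Lm!] at a cost of only O(M)
    errors ([drift_close], [shift_unnoticed]). If no such coincidence occurs, the middle state
    carries about ln [Lm] nats about the count ([pbad_le]), which the chain rule allows only rarely.
    Hence S is at least of order [L * k * ln Lm] ([long_stream_bound]).

    With [Lm] about (ln W)^(1/4) the streams fit into length W when W is huge ([space_very_long]).
    For smaller W, ln ln W is O(ln (eps^-2 ln n)), and the short-stream bound already gives the
    quotient ([space_general]). *)

(** * Finite averages, conditional expectation, resampling *)

Section Averages.
Context {R : realType}.

Definition avg (T : finType) (f : T -> R) : R := (\sum_x f x) / #|T|%:R.

Lemma avg_eq (T : finType) (f g : T -> R) : f =1 g -> avg f = avg g.
Proof. by move=> fg; rewrite /avg; congr (_ / _); apply: eq_bigr => x _. Qed.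

Lemma avgD (T : finType) (f g : T -> R) :
  avg (fun x => f x + g x) = avg f + avg g.
Proof. by rewrite /avg big_split mulrDl. Qed.

Lemma avgN (T : finType) (f : T -> R) : avg (fun x => - f x) = - avg f.
Proof. by rewrite /avg sumrN mulNr. Qed.

Lemma avgB (T : finType) (f g : T -> R) :
  avg (fun x => f x - g x) = avg f - avg g.
Proof. by rewrite avgD avgN. Qed.

Lemma avgMl (T : finType) (c : R) (f : T -> R) :
  avg (fun x => c * f x) = c * avg f.
Proof. by rewrite /avg -mulr_sumr mulrA. Qed.

Lemma avgMr (T : finType) (c : R) (f : T -> R) :
  avg (fun x => f x * c) = avg f * c.
Proof. by rewrite /avg -mulr_suml mulrAC. Qed.

Lemma avg_cst (T : finType) (x0 : T) (c : R) : avg (fun _ : T => c) = c.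
Proof.
rewrite /avg sumr_const -[c *+ _]mulr_natr mulfK//.
by rewrite pnatr_eq0 -lt0n; apply/card_gt0P; exists x0.
Qed.

Lemma avg_unit (f : unit -> R) : avg f = f tt.
Proof. by rewrite -[RHS](avg_cst tt); apply: avg_eq => -[]. Qed.

Lemma ler_avg (T : finType) (f g : T -> R) :
  (forall x, f x <= g x) -> avg f <= avg g.
Proof. by move=> fg; rewrite /avg ler_wpM2r ?invr_ge0// ler_sum. Qed.

Lemma avg_ge0 (T : finType) (f : T -> R) : (forall x, 0 <= f x) -> 0 <= avg f.
Proof. by move=> f0; rewrite /avg mulr_ge0 ?invr_ge0// sumr_ge0. Qed.

Lemma avg_le_cst (T : finType) (x0 : T) (f : T -> R) (c : R) :
  (forall x, f x <= c) -> avg f <= c.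
Proof. by move=> /ler_avg; rewrite (avg_cst x0). Qed.

Lemma avg_ge_cst (T : finType) (x0 : T) (f : T -> R) (c : R) :
  (forall x, c <= f x) -> c <= avg f.
Proof. by move=> h; rewrite -[leLHS](avg_cst x0); exact: ler_avg. Qed.

Lemma avg_sum (T : finType) (I : Type) (r : seq I) (P : pred I) (f : T -> I -> R) :
  avg (fun x => \sum_(i <- r | P i) f x i) = \sum_(i <- r | P i) avg (f^~ i).
Proof. by rewrite /avg exchange_big /= mulr_suml. Qed.

Lemma avg_pair (T U : finType) (f : T -> U -> R) :
  avg (fun p : T * U => f p.1 p.2) = avg (fun x => avg (f x)).
Proof.
rewrite /avg card_prod natrM invfM mulrC.
rewrite -(pair_big xpredT xpredT f) /= mulr_suml mulr_sumr.
by apply: eq_bigr => x _; rewrite mulrC mulrA mulrAC.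
Qed.

Lemma avg_pairE (T U : finType) (f : T * U -> R) :
  avg f = avg (fun x => avg (fun y => f (x, y))).
Proof. by rewrite -(avg_pair (fun x y => f (x, y))); apply: avg_eq => -[]. Qed.

Lemma avg_swap (T U : finType) (f : T -> U -> R) :
  avg (fun x => avg (f x)) = avg (fun y => avg (f^~ y)).
Proof.
rewrite /avg -!mulr_suml exchange_big /= -!mulrA; congr (_ * _).
by rewrite mulrC.
Qed.

Lemma avg_reindex (T U : finType) (h : T -> U) (f : U -> R) :
  bijective h -> avg f = avg (f \o h).
Proof.
move=> hb; rewrite /avg (reindex h) /=; last exact: onW_bij.
by rewrite (bij_eq_card hb).
Qed.

Lemma avg_exists (T : finType) (x0 : T) (f : T -> R) (c : R) :
  c <= avg f -> exists x, c <= f x.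
Proof.
move=> cf; apply/not_existsP => nx.
have : avg f < avg (fun _ : T => c).
  rewrite /avg ltr_pM2r; last by rewrite invr_gt0 ltr0n; apply/card_gt0P; exists x0.
  apply: ltr_sum; last by move=> x _; rewrite ltNge; apply/negP/nx.
  by apply/hasP; exists x0; rewrite ?mem_index_enum.
by rewrite (avg_cst x0) ltNge cf.
Qed.

Lemma avg_exists_le (T : finType) (x0 : T) (f : T -> R) (c : R) :
  avg f <= c -> exists x, f x <= c.
Proof.
move=> fc; have [|x] := @avg_exists T x0 (fun x => - f x) (- c).
  by rewrite avgN lerN2.
by rewrite lerN2; exists x.
Qed.

Lemma avg_markov (T : finType) (x0 : T) (f : T -> R) (c e : R) :
  (forall x, 0 <= f x) -> avg f <= e -> 0 < c ->
  1 - c^-1 <= avg (fun x => (f x <= c * e)%R%:R).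
Proof.
move=> f0 fe c0.
have e0 : 0 <= e by apply: le_trans fe; exact: avg_ge0.
(* For [e = 0] the threshold degenerates, but then [f] vanishes identically. *)
have [e00|epos] : e = 0 \/ 0 < e.
  by move: e0; rewrite le_eqVlt => /orP[/eqP<-|]; [left|right].
  suff fx0 x : f x = 0.
    apply: avg_ge_cst => // x; rewrite fx0 e00 mulr0 lexx.
    by rewrite lerBlDr lerDl invr_ge0 ltW.
  have s0 : \sum_y f y = 0.
    apply/eqP; rewrite eq_le sumr_ge0// andbT.
    move: fe; rewrite e00 /avg pmulr_lle0// invr_gt0 ltr0n.
    by apply/card_gt0P; exists x0.
  move/eqP: s0; rewrite psumr_eq0// => /allP/(_ x).
  by rewrite mem_index_enum => /(_ isT)/implyP/(_ isT)/eqP.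
have h x : 1 - (c * e)^-1 * f x <= (f x <= c * e)%R%:R.
  have [_|lt] := leP (f x) (c * e).
    by rewrite lerBlDr lerDl mulr_ge0// invr_ge0 mulr_ge0// ltW.
  rewrite subr_le0 -(mulVf (lt0r_neq0 (mulr_gt0 c0 epos))).
  by rewrite ler_wpM2l ?invr_ge0 ?mulr_ge0// ltW.
apply: le_trans (ler_avg h); rewrite avgB avgMl (avg_cst x0) lerB//.
rewrite invfM -mulrA ler_piMr ?invr_ge0 ?(ltW c0)//.
by rewrite mulrC ler_pdivrMr// mul1r.
Qed.

(** Conditional expectation given [pi = u]; it is 0 on an empty fibre. *)
Definition condE (T : finType) (U : eqType) (pi : T -> U) (f : T -> R) (u : U) : R :=
  (\sum_(x | pi x == u) f x) / #|[pred x | pi x == u]|%:R.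

Lemma avg_condE (T : finType) (U : eqType) (pi : T -> U) (f : T -> R) (g : U -> R) :
  avg (fun x => condE pi f (pi x) * g (pi x)) = avg (fun x => f x * g (pi x)).
Proof.
rewrite /avg; congr (_ / _); rewrite /condE.
under eq_bigr => x _ do rewrite -mulrA mulr_suml big_mkcond /=.
rewrite exchange_big /=; apply: eq_bigr => y _.
rewrite -big_mkcond /=.
under eq_bigl => x do rewrite eq_sym.
under eq_bigr => x /eqP -> do [].
rewrite sumr_const -[X in _ *+ X]/(#|[pred x | pi x == pi y]|) -[LHS]mulr_natr.
rewrite -!mulrA; congr (_ * _); rewrite mulrCA mulVf ?mulr1//.
by rewrite pnatr_eq0 -lt0n; apply/card_gt0P; exists y; rewrite inE.
Qed.

Lemma condE_cst (T : finType) (U : eqType) (pi : T -> U) (c : R) (x : T) :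
  condE pi (fun=> c) (pi x) = c.
Proof.
rewrite /condE sumr_const -[X in _ *+ X]/(#|[pred y | pi y == pi x]|).
rewrite -[c *+ _]mulr_natr mulfK// pnatr_eq0 -lt0n.
by apply/card_gt0P; exists x; rewrite inE.
Qed.

Lemma condE_sum (T I : finType) (U : eqType) (pi : T -> U) (f : T -> I -> R) (u : U) :
  \sum_i condE pi (f^~ i) u = condE pi (fun x => \sum_i f x i) u.
Proof. by rewrite /condE -mulr_suml exchange_big. Qed.

Lemma condE_norm_le1 (T : finType) (U : eqType) (pi : T -> U) (f : T -> R) (u : U) :
  (forall x, `|f x| <= 1) -> `|condE pi f u| <= 1.
Proof.
move=> f1; rewrite /condE normrM [`|_^-1|]ger0_norm ?invr_ge0//.
have [c0|cn0] := eqVneq #|[pred x | pi x == u]| 0%N.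
  by rewrite c0 invr0 mulr0 ler01.
rewrite ler_pdivrMr ?mul1r ?ltr0n ?lt0n//.
apply: le_trans (ler_norm_sum _ _ _) _.
rewrite -sum1_card natr_sum.
by apply: ler_sum => x _.
Qed.

(** Pythagoras: conditional expectation is an orthogonal projection. *)
Lemma avg_sqr_condE (T : finType) (U : eqType) (pi : T -> U) (f : T -> R) :
  avg (fun x => (f x - condE pi f (pi x)) ^+ 2) =
  avg (fun x => f x ^+ 2) - avg (fun x => condE pi f (pi x) ^+ 2).
Proof.
have h := avg_condE pi f (condE pi f).
rewrite (@avg_eq _ _ (fun x => f x ^+ 2 - 2 * (f x * condE pi f (pi x)) +
  condE pi f (pi x) * condE pi f (pi x))); last by move=> x; ring.
by rewrite avgD avgB avgMl h; ring.
Qed.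

Section Merge.
Context {I A : finType}.
Implicit Types (X Y : {set I}) (f g h : {ffun I -> A}).

(** For independent uniform [f] and [g] this is [f] resampled off [X]; averaging over [g] alone is
    conditioning on the coordinates in [X]. *)
Definition merge X f g : {ffun I -> A} :=
  [ffun q => if q \in X then f q else g q].

Definition upd f (j : I) (a : A) : {ffun I -> A} :=
  [ffun q => if q == j then a else f q].

Lemma merge_id X f : merge X f f = f.
Proof. by apply/ffunP => q; rewrite ffunE if_same. Qed.

Lemma merge_sub X Y f g h : X \subset Y -> merge X (merge Y f g) h = merge X f h.
Proof.
move=> /fintype.subsetP XY; apply/ffunP => q; rewrite !ffunE.
by case: ifP => // /XY ->.
Qed.

Lemma avg_merge X (F : {ffun I -> A} -> R) :
  avg (fun f => avg (fun g => F (merge X f g))) = avg F.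
Proof.
(* Exchanging the two functions off [X] preserves the uniform measure on pairs and turns the merged
   function into the first component. *)
pose sw (p : {ffun I -> A} * {ffun I -> A}) := (merge X p.1 p.2, merge X p.2 p.1).
have swK : involutive sw.
  move=> [f g]; rewrite /sw /=; congr pair; apply/ffunP => q; rewrite !ffunE;
    by case: (q \in X).
rewrite -(avg_pair (fun f g => F (merge X f g))).
rewrite (@avg_reindex _ _ sw) /=; last by exists sw.
rewrite (@avg_eq _ _ (fun p => F p.1)); last first.
  by move=> p /=; rewrite -[in RHS](swK p).
rewrite (avg_pair (fun f g => F f)).
have [/eqP c0|cn0] := eqVneq #|{ffun I -> A}| 0%N.
  by rewrite /avg (eqP c0) invr0 !mulr0.
have /card_gt0P[f0 _] : (0 < #|{ffun I -> A}|)%N by rewrite lt0n.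
by apply: avg_eq => f; rewrite (avg_cst f0).
Qed.

Lemma avg_upd (j : I) (a0 : A) (F : {ffun I -> A} -> R) :
  avg (fun a => avg (fun f => F (upd f j a))) = avg F.
Proof.
pose sw (p : A * {ffun I -> A}) := (p.2 j, upd p.2 j p.1).
have swK : involutive sw.
  move=> [a f]; rewrite /sw /=; congr pair; first by rewrite ffunE eqxx.
  by apply/ffunP => q; rewrite !ffunE; case: eqP => // ->.
rewrite -(avg_pair (fun a f => F (upd f j a))).
rewrite (@avg_reindex _ _ sw) /=; last by exists sw.
rewrite (@avg_eq _ _ (fun p => F p.2)); last first.
  by move=> p /=; rewrite -[in RHS](swK p).
by rewrite (avg_pair (fun a f => F f)) (avg_cst a0).
Qed.

End Merge.
End Averages.

                                             

(** * Conditional entropy *)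

Lemma ln_le_subr1 (R : realType) (x : R) : 0 < x -> ln x <= x - 1.
Proof. by move=> x0; rewrite -{1}[x](addrNK 1) addrC le_ln1Dx// ltrBrDr addrC subrr. Qed.

Section Information.
Context {R : realType} {I A Q : finType} (V : {ffun I -> A} -> Q).
Implicit Types (X Y : {set I}) (f g : {ffun I -> A}).

Definition cprob X f (v : Q) : R := avg (fun g => (V (merge X f g) == v)%:R).

                                                                       
                                           
(** The entropy of [V f], in nats, given the coordinates of a uniform [f] in [X]. *)
Definition centropy X : R := avg (fun f => - ln (cprob X f (V f))).

Lemma cprob_merge X Y f g v : X \subset Y -> cprob X (merge Y f g) v = cprob X f v.
Proof. by move=> XY; apply: avg_eq => h; rewrite merge_sub. Qed.

Lemma cprob_gt0 X f : 0 < cprob X f (V f).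
Proof.
have /card_gt0P cf : exists f : {ffun I -> A}, f \in {ffun I -> A} by exists f.
rewrite /cprob /avg mulr_gt0 ?invr_gt0 ?ltr0n//.
by rewrite (bigD1 f) //= merge_id eqxx ltr_wpDr// sumr_ge0.
Qed.

Lemma cprob_ge0 X f v : 0 <= cprob X f v.
Proof. by apply: avg_ge0 => g; rewrite ler0n. Qed.

Lemma cprob_le1 X f v : cprob X f v <= 1.
Proof. by apply: (avg_le_cst f) => g; case: eqP; rewrite ?lexx ?ler01. Qed.

Lemma avg_cprob X f (G : Q -> R) :
  avg (fun g => G (V (merge X f g))) = \sum_v cprob X f v * G v.
Proof.
rewrite /cprob; under [RHS]eq_bigr do rewrite -avgMr.
rewrite -avg_sum; apply: avg_eq => g.
rewrite (bigD1 (V (merge X f g))) //= eqxx mul1r big1 ?addr0// => v.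
by rewrite eq_sym => /negbTE->; rewrite mul0r.
Qed.

Lemma centropy_ge0 X : 0 <= centropy X.
Proof.
apply: avg_ge0 => f; rewrite oppr_ge0.
by apply: ln_le0; exact: cprob_le1.
Qed.

(** Apply ln x <= x - 1 at 1/(pM); the average of 1/p counts the values that occur with positive
    probability. *)
Lemma centropy_le X (M : nat) : (#|Q| <= M)%N -> (0 < M)%N ->
  centropy X <= ln M%:R.
Proof.
move=> QM M0.
have M0' : 0 < M%:R :> R by rewrite ltr0n.
have [c0|cn0] := eqVneq #|{ffun I -> A}| 0%N.
  by rewrite /centropy /avg c0 invr0 mulr0 ln_ge0// ler1n.
have /card_gt0P[f0 _] : (0 < #|{ffun I -> A}|)%N by rewrite lt0n.
have h f : - ln (cprob X f (V f)) <= (cprob X f (V f))^-1 / M%:R + (ln M%:R - 1).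
  have p0 := cprob_gt0 X f.
  have : ln ((cprob X f (V f))^-1 / M%:R) <= (cprob X f (V f))^-1 / M%:R - 1.
    by apply: ln_le_subr1; rewrite divr_gt0 ?invr_gt0.
  by rewrite ln_div ?posrE ?invr_gt0// lnV ?posrE//; lra.
apply: le_trans (ler_avg h) _.
rewrite avgD (avg_cst f0) avgMr.
suff : avg (fun f => (cprob X f (V f))^-1) <= M%:R.
  by rewrite -[leRHS]mul1r -ler_pdivrMr//; lra.
rewrite -(avg_merge X).
apply: (avg_le_cst f0) => f.
under avg_eq do rewrite cprob_merge//.
rewrite (avg_cprob X f (fun v => (cprob X f v)^-1)).
apply: (@le_trans _ _ (\sum_(v : Q) 1)); last by rewrite sumr_const ler_nat.
apply: ler_sum => v _.
by have [->|n0] := eqVneq (cprob X f v) 0; rewrite ?mul0r ?ler01// mulfV.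
Qed.

                                                                                 
                                                         
(** Variational lower bound for the mutual information of [V] and [f j] given the coordinates in
    [X]: a test function [G] of the value and the coordinates in [j |: X] is compared under the
    joint law and under the law where [V] is redrawn without regard to [f j]. It is ln r <= r - 1
    for [r], which is [G] times the likelihood ratio. *)
Lemma centropy_gain (f0 : {ffun I -> A}) X (j : I) (G : {ffun I -> A} -> Q -> R) :
  (forall f v, 0 < G f v) ->
  (forall f g v, G (merge (j |: X) f g) v = G f v) ->
  avg (fun f => ln (G f (V f)))
    - avg (fun f => avg (fun g => G f (V (merge X f g)))) + 1
  <= centropy X - centropy (j |: X).
Proof.
move=> G0 GX; pose Xj := j |: X.
have sX : X \subset Xj by exact: finset.subsetUr.
pose r f v := cprob X f v * G f v / cprob Xj f v.
have h f : ln (G f (V f)) - r f (V f) + 1 <=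
    - ln (cprob X f (V f)) - - ln (cprob Xj f (V f)).
  have p0 := cprob_gt0 X f; have pj0 := cprob_gt0 Xj f.
  have : ln (r f (V f)) <= r f (V f) - 1.
    exact: ln_le_subr1 (divr_gt0 (mulr_gt0 p0 (G0 _ _)) pj0).
  rewrite {1}/r ln_div ?posrE ?(mulr_gt0 p0)// lnM ?posrE//; lra.
rewrite /centropy -[leRHS]avgB; apply: le_trans (ler_avg h).
rewrite avgD (avg_cst f0) avgB lerD2r lerD2l lerN2.
rewrite -(avg_merge Xj); apply: ler_avg => f.
rewrite (@avg_eq _ _ _ (fun g => r f (V (merge Xj f g)))); last first.
  by move=> g; rewrite /r cprob_merge// GX cprob_merge.
rewrite avg_cprob (avg_cprob X f (G f)); apply: ler_sum => v _.
rewrite /r; have [->|n0] := eqVneq (cprob Xj f v) 0.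
  by rewrite mul0r mulr_ge0 ?cprob_ge0// ltW.
by rewrite mulrC divfK.
Qed.

Lemma centropy_anti (f0 : {ffun I -> A}) X (j : I) : centropy (j |: X) <= centropy X.
Proof.
have := @centropy_gain f0 X j (fun _ _ => 1) (fun _ _ => ltr01) (fun _ _ _ => erefl).
under [X in _ - X]avg_eq => f do rewrite (avg_cst f0).
by rewrite ln1 !(avg_cst f0); lra.
Qed.

End Information.

(** * Random signs and correlation *)

Section RandomSigns.
Context {R : realType} {I : finType}.
Implicit Types (b y : {ffun I -> bool}) (s : seq I) (J : {set I}).

Definition sg (b : bool) : R := (-1) ^+ b.

Lemma sgK (c : bool) : sg c * sg c = 1.
Proof. by rewrite /sg; case: c; rewrite /= ?expr1 ?expr0; ring. Qed.

Lemma norm_sg (c : bool) : `|sg c| = 1.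
Proof. by rewrite /sg normrX normrN1 expr1n. Qed.

Lemma sg_neg (c : bool) : sg (~~ c) = - sg c.
Proof. by rewrite /sg; case: c; rewrite /= ?expr1 ?expr0 ?opprK. Qed.

Lemma avg_flip (j : I) (F : {ffun I -> bool} -> R) :
  avg F = avg (fun b => F (upd b j (~~ b j))).
Proof.
apply: (@avg_reindex _ _ _ (fun b => upd b j (~~ b j))).
have K : involutive (fun b : {ffun I -> bool} => upd b j (~~ b j)).
  move=> b; apply/ffunP => q; rewrite !ffunE eqxx negbK.
  by case: eqP => // ->.
by exists (fun b => upd b j (~~ b j)).
Qed.

Lemma avg_odd (j : I) (F : {ffun I -> bool} -> R) :
  (forall b, F (upd b j (~~ b j)) = - F b) -> avg F = 0.
Proof.
move=> odd; have : avg F = - avg F.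
  by rewrite {1}(avg_flip j) -avgN; exact: avg_eq.
by lra.
Qed.

Definition wsum s (c : I -> R) b : R := \sum_(j <- s) c j * sg (b j).

Lemma wsum_upd s c b j a : j \notin s -> wsum s c (upd b j a) = wsum s c b.
Proof.
move=> js; rewrite /wsum; apply: eq_big_seq => q qs.
by rewrite ffunE ifN//; apply: contraNneq js => <-.
Qed.

(** Induction on the index list; cross terms of odd degree in the new sign vanish by flipping it. *)
Lemma avg_wsum_moments s c : uniq s ->
  avg (fun b => wsum s c b ^+ 2) = \sum_(j <- s) c j ^+ 2 /\
  avg (fun b => wsum s c b ^+ 4) <= 3 * (\sum_(j <- s) c j ^+ 2) ^+ 2.
Proof.
elim: s => [_|j s IH /= /andP[js us]].
  rewrite big_nil /wsum; split.
    under avg_eq do rewrite big_nil expr0n /=.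
    by rewrite (avg_cst [ffun=> true]).
  under avg_eq do rewrite big_nil expr0n /=.
  by rewrite (avg_cst [ffun=> true]) expr0n /= mulr0.
have {us}[m2 m4] := IH us.
have oddE (k : nat) : avg (fun b => sg (b j) * wsum s c b ^+ k) = 0.
  by apply: (avg_odd (j := j)) => b; rewrite wsum_upd// ffunE eqxx sg_neg mulNr.
have s2 b : sg (b j) ^+ 2 = 1 by rewrite expr2 sgK.
rewrite big_cons; split.
  rewrite (@avg_eq _ _ _ (fun b => (c j ^+ 2 + (2 * c j) * (sg (b j) * wsum s c b ^+ 1))
      + wsum s c b ^+ 2)); last first.
    move=> b; rewrite {1}/wsum big_cons -/(wsum s c b).
    rewrite (_ : (c j * sg (b j) + wsum s c b) ^+ 2 = c j ^+ 2 * sg (b j) ^+ 2 +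
      2 * c j * sg (b j) * wsum s c b + wsum s c b ^+ 2); last by ring.
    by rewrite s2; ring.
  by rewrite avgD avgD avgMl oddE mulr0 addr0 m2 (avg_cst [ffun=> true]).
rewrite (@avg_eq _ _ _ (fun b => ((c j ^+ 4 + 6 * c j ^+ 2 * wsum s c b ^+ 2)
   + ((4 * c j ^+ 3) * (sg (b j) * wsum s c b ^+ 1)
   + (4 * c j) * (sg (b j) * wsum s c b ^+ 3))) + wsum s c b ^+ 4)); last first.
  move=> b; rewrite {1}/wsum big_cons -/(wsum s c b).
  have s3 : sg (b j) ^+ 3 = sg (b j) by rewrite exprS s2 mulr1.
  have s4 : sg (b j) ^+ 4 = 1 by rewrite (exprM _ 2 2) s2 expr1n.
  rewrite (_ : (c j * sg (b j) + wsum s c b) ^+ 4 =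
     c j ^+ 4 * sg (b j) ^+ 4 + 4 * c j ^+ 3 * sg (b j) ^+ 3 * wsum s c b
     + 6 * c j ^+ 2 * sg (b j) ^+ 2 * wsum s c b ^+ 2
     + 4 * c j * sg (b j) * wsum s c b ^+ 3 + wsum s c b ^+ 4); last by ring.
  by rewrite s2 s3 s4; ring.
rewrite avgD avgD (@avgD _ _ (fun=> c j ^+ 4)) (@avgD _ _ (fun b => _ * (_ * wsum s c b ^+ 1))).
rewrite !avgMl !oddE m2 (avg_cst [ffun=> true]).
have : 0 <= c j ^+ 4 by rewrite (exprM _ 2 2) sqr_ge0.
by set x := \sum_(q <- s) _ in m2 m4 *; move: m4; lra.
Qed.

Definition corr J b y : R := \sum_(j in J) sg (b j) * sg (y j).

Lemma corrE J b y : corr J b y = wsum (enum J) (fun j => sg (b j)) y.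
Proof. by rewrite /corr /wsum -big_enum. Qed.

Lemma sum_sg2 J b : \sum_(j <- enum J) sg (b j) ^+ 2 = #|J|%:R.
Proof.
rewrite (eq_bigr (fun=> 1)); last by move=> j _; rewrite expr2 sgK.
by rewrite big_const_seq count_predT -cardE iter_addr_0.
Qed.

(** A polynomial minorant of the absolute value, so that second and fourth moments bound the first
    from below. *)
Lemma le_norm_quartic (x : R) : x ^+ 2 - x ^+ 4 / 4 <= `|x|.
Proof.
rewrite -(real_normK (num_real x)) (exprM _ 2 2) -(real_normK (num_real x)).
have := normr_ge0 x; set z := `|x| => z0.
have -> : z ^+ 2 - (z ^+ 2) ^+ 2 / 4 = z * (z - z ^+ 3 / 4) by field.
rewrite -[leRHS]mulr1 ler_wpM2l//.
(* 6/5 is close to the minimiser 2/sqrt 3 of 1 - z + z^3/4; the square is a tangent-line bound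
   there. *)
have : 0 <= (z - 6 / 5) ^+ 2 * (z + 12 / 5) by rewrite mulr_ge0 ?sqr_ge0// addr_ge0.
have -> : (z - 6 / 5) ^+ 2 * (z + 12 / 5) = z ^+ 3 - 108 / 25 * z + 432 / 125 by field.
by lra.
Qed.

(** Khinchine's lower bound: rescale by k = sqrt |J| in [le_norm_quartic]; the moments give k -
    3k/4. *)
Lemma avg_norm_corr J :
  Num.sqrt #|J|%:R / 4 <= avg (fun b => avg (fun y => `|corr J b y|)).
Proof.
apply: (avg_ge_cst [ffun=> true]) => b.
have [->|n0] := eqVneq J finset.set0.
  by rewrite cards0 sqrtr0 mul0r avg_ge0// => y; rewrite normr_ge0.
have c0 : 0 < #|J|%:R :> R by rewrite ltr0n card_gt0.
set k := Num.sqrt _; have k0 : 0 < k by rewrite sqrtr_gt0.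
have k2 : k ^+ 2 = #|J|%:R by rewrite sqr_sqrtr// ltW.
have [] := @avg_wsum_moments (enum J) (fun j => sg (b j)) (enum_uniq _).
rewrite sum_sg2 -k2 => m2 m4.
have h y : k^-1 * wsum (enum J) (fun j => sg (b j)) y ^+ 2
    - (4 * k ^+ 3)^-1 * wsum (enum J) (fun j => sg (b j)) y ^+ 4 <= `|corr J b y|.
  rewrite corrE; set w := wsum _ _ _.
  have := le_norm_quartic (w / k).
  rewrite -(ler_pM2l k0) normrM [`|k^-1|]gtr0_norm ?invr_gt0// mulrCA mulfV ?mulr1 ?gt_eqF//.
  apply: le_trans; rewrite le_eqVlt; apply/orP; left; apply/eqP; field.
  by rewrite gt_eqF.
apply: le_trans (ler_avg h); rewrite avgB !avgMl m2.
have : (4 * k ^+ 3)^-1 * avg (fun b0 => wsum (enum J) (fun j => sg (b j)) b0 ^+ 4) <=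
   (4 * k ^+ 3)^-1 * (3 * (k ^+ 2) ^+ 2).
  by rewrite ler_wpM2l// invr_ge0 mulr_ge0// exprn_ge0// ltW.
have -> : (4 * k ^+ 3)^-1 * (3 * (k ^+ 2) ^+ 2) = 3 / 4 * k by field; rewrite gt_eqF.
have -> : k^-1 * k ^+ 2 = k by field; rewrite gt_eqF.
by lra.
Qed.

                                                                        
                                                                              
                                                                                  
(** [phi j] is the conditional mean of the sign of [b j] given the message. For a fixed message only
    these means correlate with [y], and a decision bounded by 1 gains at most the mean absolute
    value of their signed sum, at most the root of the sum of their squares. The second clause is
    the tower property. *)
Lemma correlation_bias (Omega : finType) (w0 : Omega) (U : eqType)
    (msg : Omega -> {ffun I -> bool} -> U) (o : U -> {ffun I -> bool} -> R)
    (J : {set I}) (alpha : R) :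
  (forall u y, `|o u y| <= 1) -> 0 < alpha ->
  alpha <= avg (fun w => avg (fun b => avg (fun y => o (msg w b) y * corr J b y))) ->
  exists phi : I -> U -> R,
    [/\ forall j u, `|phi j u| <= 1,
        forall j, avg (fun w => avg (fun b => sg (b j) * phi j (msg w b))) =
                  avg (fun w => avg (fun b => phi j (msg w b) ^+ 2)) &
        alpha ^+ 2 <= \sum_(j in J) avg (fun w => avg (fun b => phi j (msg w b) ^+ 2))].
Proof.
move=> o1 a0 ha.
pose pi (p : Omega * {ffun I -> bool}) := msg p.1 p.2.
pose phi j := condE pi (fun p => sg (p.2 j)).
have phi1 j u : `|phi j u| <= 1 by apply: condE_norm_le1 => p; rewrite norm_sg.
exists phi; split => //.
  move=> j.
  rewrite -(avg_pair (fun w b => sg (b j) * phi j (msg w b))).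
  rewrite -(avg_pair (fun w b => phi j (msg w b) ^+ 2)).
  by rewrite -(avg_condE pi (fun p => sg (p.2 j)) (phi j)).
have step : avg (fun w => avg (fun b => avg (fun y => o (msg w b) y * corr J b y))) =
   avg (fun p => avg (fun y => o (pi p) y * wsum (enum J) (phi^~ (pi p)) y)).
  rewrite -(avg_pair (fun w b => avg (fun y => o (msg w b) y * corr J b y))).
  rewrite [LHS]avg_swap [RHS]avg_swap; apply: avg_eq => y.
  under avg_eq do rewrite /corr mulr_sumr.
  under [RHS]avg_eq do rewrite /wsum mulr_sumr.
  rewrite !avg_sum big_enum /=; apply: eq_bigr => j _.
  have := avg_condE pi (fun p => sg (p.2 j)) (fun u => o u y * sg (y j)).
  rewrite -/(phi j) => /esym e.
  rewrite [LHS](@avg_eq _ _ _ (fun x : Omega * {ffun I -> bool} => sg (x.2 j) * (o (pi x) y * sg (y j)))); last first.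
    by move=> p; rewrite /pi; ring.
  by rewrite e; apply: avg_eq => p; ring.
move: ha; rewrite step => ha.
(* The arithmetic-geometric mean inequality with weight [alpha] replaces the square root, so that
   averaging over messages stays linear. *)
have h p : avg (fun y => o (pi p) y * wsum (enum J) (phi^~ (pi p)) y) <=
    (alpha + alpha^-1 * \sum_(j in J) phi j (pi p) ^+ 2) / 2.
  have [m2 _] := @avg_wsum_moments (enum J) (phi^~ (pi p)) (enum_uniq _).
  rewrite big_enum /= in m2; rewrite -m2.
  apply: (@le_trans _ _ (avg (fun y =>
      (alpha + alpha^-1 * wsum (enum J) (phi^~ (pi p)) y ^+ 2) / 2))); last first.
    by rewrite avgMr avgD avgMl (avg_cst [ffun=> true]).
  apply: ler_avg => y; set x := wsum _ _ _.
  apply: (@le_trans _ _ `|x|).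
    apply: le_trans (ler_norm _) _; rewrite normrM.
    by rewrite ler_piMl.
  rewrite -(ler_pM2l a0).
  have -> : alpha * ((alpha + alpha^-1 * x ^+ 2) / 2) = (alpha ^+ 2 + `|x| ^+ 2) / 2.
    by rewrite real_normK ?num_real//; field; rewrite gt_eqF.
  have : 0 <= (alpha - `|x|) ^+ 2 by exact: sqr_ge0.
  by rewrite sqrrB; lra.
have := le_trans ha (ler_avg h).
rewrite avgMr avgD avgMl (avg_cst (w0, [ffun=> true])) avg_sum.
set E := \sum_(j in J) avg _; set E' := (\sum_(j in J) _).
have -> : E = E'.
  by apply: eq_bigr => j _; rewrite -(avg_pair (fun w b => phi j (msg w b) ^+ 2)).
move=> le1; rewrite -(@ler_pM2l _ alpha^-1) ?invr_gt0//.
by rewrite expr2 mulKf ?gt_eqF//; lra.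
Qed.

End RandomSigns.

                            

(** * Sums over integer intervals *)

Section NatSums.
Context {R : realType}.

Lemma ler_sum_nat_sub (F : nat -> R) (a b c d : nat) :
  (forall n, 0 <= F n) -> (a <= b)%N -> (c <= d)%N ->
  \sum_(b <= n < c) F n <= \sum_(a <= n < d) F n.
Proof.
move=> F0 ab cd; have [bc|cb] := leqP b c; last first.
  by rewrite big_geq 1?ltnW// sumr_ge0.
rewrite (@big_cat_nat _ _ _ b a d) //=; last exact: leq_trans bc cd.
rewrite (@big_cat_nat _ _ _ c b d) //= addrCA lerDl addr_ge0// sumr_ge0//.
Qed.

Lemma sum_shift_le (g : nat -> R) (N r : nat) : (forall n, `|g n| <= 1) ->
  \sum_(0 <= m < N) (g m - g (m + r)%N) <= 2 * r%:R.
Proof.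
move=> g1; elim: r => [|r IH].
  by rewrite big1 ?mulr0// => m _; rewrite addn0 subrr.
rewrite (eq_bigr (fun m => (g m - g (m + r)%N) - (g (m.+1 + r)%N - g (m + r)%N))); last first.
  by move=> m _; rewrite addnS addSn; ring.
rewrite sumrB (telescope_sumr (fun m => g (m + r)%N)) // add0n.
rewrite -[r.+1%:R]natr1 mulrDr mulr1 lerD//.
by have := g1 (N + r)%N; have := g1 r; rewrite !ler_norml; lra.
Qed.

Lemma sum_nat_shift (F : nat -> R) (a N : nat) :
  \sum_(a <= n < a + N) F n = \sum_(0 <= m < N) F (a + m)%N.
Proof.
rewrite -[X in \sum_(X <= _ < _) _]add0n big_addn addKn.
by apply: eq_bigr => m _; rewrite addnC.
Qed.

Lemma sum_nat_le_cst (F : nat -> R) (a b : nat) (c : R) :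
  (forall n, F n <= c) -> \sum_(a <= n < b) F n <= c * (b - a)%:R.
Proof.
move=> Fc; apply: (@le_trans _ _ (\sum_(a <= n < b) c)); first exact: ler_sum.
by rewrite sumr_const_nat mulr_natr.
Qed.

End NatSums.

                                                                                    
                                                                                
                                                                                  
                                                                                       
(** * Approximate periodicity of the final law in the total count *)

Section ApproximatePeriod.
Context {R : realType} {Q H1 H2 : finType} (h1 : H1) (h2 : H2).
Variables (M Lm T' : nat) (v : nat -> H1 -> Q).
Variables (kap : Q -> nat -> H2 -> Q -> R) (Phi : nat -> Q -> R).

Local Notation r := (Lm`!).
Local Notation T := ((Lm`!).*2).

(** In the application [v a y1] is the middle state after [a] copies of the examined block, [kap]
    the law of the final state from there after [m] further copies, and [Phi n] that law when only
    the sum [n] is disclosed. [merr] measures how much [kap] depends on more than the sum. *)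
Definition dist n n' : R := \sum_o `|Phi n o - Phi n' o|.
Definition gap (a : nat) y1 (m : nat) y2 : R :=
  \sum_o `|kap (v a y1) m y2 o - Phi (a + m)%N o|.
Definition err a y1 : R := avg (fun m : 'I_T' => avg (fun y2 => gap a y1 m y2)).
Definition merr : R := avg (fun a : 'I_T => avg (fun y1 => err a y1)).
(** The threshold [4 * merr] is chosen so that, by Markov, three quarters of all pairs qualify. *)
Definition visits v0 (a : nat) := [exists y, (v a y == v0) && (err a y <= 4 * merr)].
Definition close_visits := [exists a : 'I_T, exists a' : 'I_T, exists v0,
  (a < a' <= a + Lm)%N && (visits v0 a && visits v0 a')].

Let r_gt0 : (0 < r)%N. Proof. exact: fact_gt0. Qed.
Let TE : T = (r + r)%N. Proof. by rewrite addnn. Qed.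
Let T_gt0 : (0 < T)%N. Proof. by rewrite TE; have := r_gt0; lia. Qed.

Let gap_ge0 a y1 m y2 : 0 <= gap a y1 m y2.
Proof. exact: sumr_ge0. Qed.
Let err_ge0 a y1 : 0 <= err a y1.
Proof. by do 2 (apply: avg_ge0 => ?). Qed.
Lemma merr_ge0 : 0 <= merr.
Proof. by do 2 (apply: avg_ge0 => ?). Qed.
Let dist_ge0 n n' : 0 <= dist n n'.
Proof. exact: sumr_ge0. Qed.
Let dist_tri n p q : dist n q <= dist n p + dist p q.
Proof.
rewrite /dist -big_split /=; apply: ler_sum => o _.
by apply: le_trans (ler_normD _ _); rewrite addrA subrK.
Qed.

Lemma err_mass :
  3 / 4 <= avg (fun a : 'I_T => avg (fun y => (err a y <= 4 * merr)%R%:R : R)).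
Proof.
rewrite -(avg_pair (fun (a : 'I_T) y => (err a y <= 4 * merr)%R%:R)).
have -> : 3 / 4 = 1 - 4^-1 :> R by field.
apply: (@avg_markov _ _ (Ordinal T_gt0, h1) (fun p => err p.1 p.2)) => //.
by rewrite (avg_pair (fun (a : 'I_T) y => err a y)).
Qed.

(** Without close visits the counts that reach [v0] are more than [Lm] apart. *)
Lemma visits_sparse v0 : ~~ close_visits ->
  Lm%:R * avg (fun a : 'I_T => (visits v0 a)%:R) <= 2 :> R.
Proof.
move=> nc.
pose G := [set a : 'I_T | visits v0 a]%SET.
have cG : (#|G| <= (T %/ Lm.+1).+1)%N.
  (* Each window of [Lm + 1] consecutive counts holds at most one visit. *)
  pose f (a : 'I_T) : 'I_(T %/ Lm.+1).+1 := inord (a %/ Lm.+1).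
  have fE a : f a = (a %/ Lm.+1)%N :> nat.
    by rewrite inordK// ltnS leq_div2r// ltnW.
  rewrite -[leqRHS]card_ord -(@card_in_imset _ _ f G) ?max_card// => a a'.
  rewrite !inE => va va' /(congr1 val) /=; rewrite !fE => e.
  apply/eqP; apply: contraNT nc => ne.
  wlog lt : a a' va va' e ne / (a < a')%N.
    move=> W; case: (ltngtP a a') => [|| /val_inj/eqP]; last by rewrite (negbTE ne).
      exact: W.
    by apply: W => //; rewrite eq_sym.
  apply/existsP; exists a; apply/existsP; exists a'; apply/existsP; exists v0.
  rewrite lt va va' /= andbT.
  have := divn_eq a Lm.+1; have := divn_eq a' Lm.+1; rewrite e.
  have := ltn_pmod a' (ltn0Sn Lm); have := ltn_pmod a (ltn0Sn Lm); lia.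
have LT : (Lm <= T)%N.
  by rewrite TE; apply: leq_trans (leq_addr _ _); exact: fact_geq.
have : (Lm * #|G| <= 2 * T)%N.
  have := leq_trunc_div T Lm.+1; move: cG LT; nia.
rewrite /avg card_ord -natr_sum mulrA ler_pdivrMr ?ltr0n// -natrM -(natrM _ 2) ler_nat.
suff -> : (\sum_(a : 'I_T) visits v0 a = #|G|)%N by [].
by rewrite -sum1_card [RHS]big_mkcond /=; apply: eq_bigr => a _; rewrite inE; case: visits.
Qed.

Hypothesis T'_gt0 : (0 < T')%N.

(** From a common middle state the continuation has the same law, while the disclosed sums differ by
    [a' - a]; hence [Phi] nearly agrees at these two sums. *)
Lemma same_state a y a' y' : v a y = v a' y' ->
  \sum_(0 <= m < T') dist (a + m) (a' + m) <= T'%:R * (err a y + err a' y').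
Proof.
move=> e; rewrite big_mkord /err -avgD {1}/avg card_ord mulrC divfK ?pnatr_eq0 -?lt0n//.
apply: ler_sum => m _; rewrite -avgD; apply: (avg_ge_cst h2) => y2.
rewrite /gap e -big_split; apply: ler_sum => o _ /=.
rewrite [`|kap _ _ _ _ - Phi (a + m)%N o|]distrC.
by apply: le_trans (ler_normD _ _); rewrite addrA subrK.
Qed.

(** Total change of [Phi] under a shift by [d]; the margin [c] at the right end leaves room for
    further shifts in the triangle inequality. *)
Definition drift d c := \sum_(T <= n < T' - c) dist n (n + d).

Lemma drift_add d1 d2 c : (d1 <= c)%N ->
  drift (d1 + d2) c <= drift d1 c + drift d2 0.
Proof.
move=> d1c.
apply: (@le_trans _ _ (drift d1 c + \sum_(T <= n < T' - c) dist (n + d1) (n + d1 + d2))).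
  by rewrite /drift -big_split /=; apply: ler_sum => n _; rewrite addnA.
rewrite lerD2l /drift.
have -> : \sum_(T <= n < T' - c) dist (n + d1) (n + d1 + d2) =
   \sum_(T + d1 <= n < T' - c + d1) dist n (n + d2).
  by rewrite big_addn addnK.
have [?|?] := leqP c T'.
  by apply: ler_sum_nat_sub => //; lia.
by rewrite big_geq ?sumr_ge0//; lia.
Qed.

Lemma drift_mul q d c : (q * d <= c)%N -> drift (q * d) c <= q%:R * drift d 0.
Proof.
elim: q => [|q IH] h.
  by rewrite mul0n mul0r /drift big1// => n _; rewrite addn0 /dist big1// => o _; rewrite subrr normr0.
rewrite mulSn addnC; apply: le_trans (drift_add _ _) _; first lia.
by rewrite -[q.+1%:R]natr1 mulrDl mul1r lerD2r IH//; lia.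
Qed.

Lemma drift_same_state a d y y' : (a < T)%N -> v a y = v (a + d)%N y' ->
  drift d 0 <= T'%:R * (err a y + err (a + d) y').
Proof.
move=> aT e; apply: le_trans (same_state e).
have -> : \sum_(0 <= m < T') dist (a + m) (a + d + m) =
   \sum_(a <= n < a + T') dist n (n + d).
  by rewrite sum_nat_shift; apply: eq_bigr => m _; rewrite addnAC.
by apply: ler_sum_nat_sub => //; lia.
Qed.

Hypothesis v_periodic : forall y, exists lam,
  (0 < lam <= M)%N /\ forall a, v (a + lam)%N y = v a y.

(** The middle state repeats exactly with period [lam], so any multiple of [lam] costs a single
    comparison, however large the multiple. *)
Lemma drift_multiple_period : exists lam, (0 < lam <= M)%N /\
  forall q, (q * lam <= r)%N -> drift (q * lam) 0 <= T'%:R * (4 * merr).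
Proof.
have [y hy] : exists y, avg (fun a : 'I_T => err a y) <= merr.
  by apply: (avg_exists_le h1); rewrite avg_swap.
have [lam [lamM vl]] := v_periodic y; exists lam; split=> // q qr.
have vq a : v (a + q * lam)%N y = v a y.
  by elim: q {qr} => [|q IH]; rewrite ?addn0// mulSn addnCA addnC vl.
(* Counts range over [T = 2r], so both [a] and [a + q * lam] stay in range for all [a < r];
   averaging over these gives the factor 4. *)
have [a ha] : exists a : 'I_r, err a y + err (a + q * lam) y <= 4 * merr.
  apply: (avg_exists_le (Ordinal r_gt0)).
  rewrite avgD /avg card_ord -mulrDl ler_pdivrMr ?ltr0n//.
  have tot : \sum_(0 <= a < T) err a y <= merr * T%:R.
    by move: hy; rewrite /avg card_ord ler_pdivrMr ?ltr0n// big_mkord.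
  have s1 : \sum_(i < r) err i y <= \sum_(0 <= a < T) err a y.
    rewrite -(big_mkord xpredT (fun a => err a y)).
    by apply: ler_sum_nat_sub => //; rewrite TE; lia.
  have s2 : \sum_(i < r) err (i + q * lam) y <= \sum_(0 <= a < T) err a y.
    rewrite -(big_mkord xpredT (fun a => err (a + q * lam) y)).
    have -> : \sum_(0 <= i < r) err (i + q * lam) y =
        \sum_(q * lam <= i < r + q * lam) err i y.
      by rewrite -{2}(add0n (q * lam)%N) big_addn addnK.
    by apply: ler_sum_nat_sub => //; rewrite TE; lia.
  have -> : 4 * merr * r%:R = merr * T%:R + merr * T%:R.
    by rewrite TE natrD; ring.
  by apply: lerD; [apply: le_trans tot|apply: le_trans tot].
apply: le_trans (@drift_same_state a (q * lam) y y _ _) _ => //.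
  by rewrite TE; have := ltn_ord a; lia.
by rewrite ler_wpM2l.
Qed.

Hypothesis Phi_le1 : forall n, \sum_o `|Phi n o| <= 1.

                                                                                
                                                                                
                                                                                     
(** A coincidence at distance [d <= Lm] gives the near period [d], which divides [Lm!]. Repeating it
    [Lm! / d] times would be too expensive, so whole groups of [lam] repetitions are replaced by one
    multiple of [lam]; fewer than [M] steps of length [d] remain. *)
Lemma drift_close : close_visits -> drift r r <= T'%:R * ((8 * M%:R + 4) * merr).
Proof.
move=> /existsP[a /existsP[a' /existsP[v0 /andP[/andP[aa' a'L]]]]].
move=> /andP[/existsP[y /andP[/eqP vy ey]] /existsP[y' /andP[/eqP vy' ey']]].
have [d a'E] : exists d, a' = (a + d)%N :> nat by exists (a' - a)%N; lia.
have dd : drift d 0 <= T'%:R * (8 * merr).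
  have e : v a y = v (a + d)%N y' by rewrite -a'E vy vy'.
  apply: le_trans (drift_same_state (ltn_ord a) e) _.
  rewrite ler_wpM2l// -a'E; lra.
have dr : (d %| r)%N by apply: dvdn_fact; lia.
have [lam [/andP[lam0 lamM] dlam]] := drift_multiple_period.
move: (divnK dr); set q := (r %/ d)%N => rE.
have qE := divn_eq q lam.
have rE2 : r = ((q %% lam) * d + (q %/ lam * d) * lam)%N by lia.
rewrite {1}rE2.
apply: le_trans (@drift_add _ _ r _) _; first by rewrite [leqRHS]rE2 leq_addr.
have h1' : drift (q %/ lam * d * lam) 0 <= T'%:R * (4 * merr) by apply: dlam; rewrite [leqRHS]rE2 leq_addl.
have h2' : drift ((q %% lam) * d) r <= M%:R * (T'%:R * (8 * merr)).
  apply: le_trans (@drift_mul _ _ r _) _; first by rewrite [leqRHS]rE2 leq_addr.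
  apply: ler_pM => //; first by rewrite sumr_ge0.
  by rewrite ler_nat; have := ltn_pmod q lam0; lia.
apply: le_trans (lerD h2' h1') _.
by rewrite le_eqVlt; apply/orP; left; apply/eqP; ring.
Qed.

Let dist_le2 n n' : dist n n' <= 2.
Proof.
apply: (@le_trans _ _ (\sum_o `|Phi n o| + \sum_o `|Phi n' o|)).
  by rewrite /dist -big_split /=; apply: ler_sum => o _; exact: ler_normB.
by have := Phi_le1 n; have := Phi_le1 n'; lra.
Qed.

(** Replacing [kap] by [Phi] costs the error twice. Summation by parts then moves the shift from
    [chi] to [Phi], where [drift_close] applies; the boundary terms amount to [8 * r]. *)
Lemma shift_unnoticed (chi : Q -> nat -> R) :
  (forall o n, `|chi o n| <= 1) -> close_visits ->
  avg (fun a : 'I_T => avg (fun y1 => avg (fun m : 'I_T' => avg (fun y2 =>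
    \sum_o kap (v a y1) m y2 o * (chi o (a + m)%N - chi o (a + m + r)%N)))))
  <= (8 * M%:R + 6) * merr + 8 * r%:R / T'%:R.
Proof.
move=> chi1 cv.
have T'0 : 0 < T'%:R :> R by rewrite ltr0n.
pose X n : R := \sum_o Phi n o * (chi o n - chi o (n + r)%N).
have step1 a y1 m y2 : \sum_o kap (v a y1) m y2 o * (chi o (a + m)%N - chi o (a + m + r)%N)
    <= X (a + m)%N + 2 * gap a y1 m y2.
  rewrite /X /gap mulr_sumr -big_split; apply: ler_sum => o _ /=.
  set k := kap _ _ _ _; set p := Phi _ _; set c := _ - _.
  have c2 : `|c| <= 2.
    by apply: le_trans (ler_normB _ _) _; have := chi1 o (a + m)%N; have := chi1 o (a + m + r)%N; lra.
  rewrite -lerBlDl -mulrBl; apply: le_trans (ler_norm _) _.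
  by rewrite normrM mulrC ler_wpM2r.
have step2 a : (a < T)%N -> avg (fun m : 'I_T' => X (a + m)%N) <=
    (8 * M%:R + 4) * merr + 8 * r%:R / T'%:R.
  move=> aT.
  rewrite /avg card_ord ler_pdivrMr// mulrDl divfK ?gt_eqF//.
  rewrite -(big_mkord xpredT (fun m => X (a + m)%N)).
  pose Af n : R := \sum_o Phi n o * chi o n.
  have Af1 n : `|Af n| <= 1.
    apply: le_trans (ler_norm_sum _ _ _) _; apply: le_trans (Phi_le1 n).
    by apply: ler_sum => o _; rewrite normrM ler_piMr.
  have XA n : X n <= (Af n - Af (n + r)%N) + dist n (n + r).
    rewrite /X /Af /dist -sumrB -big_split; apply: ler_sum => o _ /=.
    have -> : Phi n o * (chi o n - chi o (n + r)%N) = Phi n o * chi o n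
      - Phi (n + r)%N o * chi o (n + r)%N + (Phi (n + r)%N o - Phi n o) * chi o (n + r)%N.
      by ring.
    rewrite lerD2l distrC; apply: le_trans (ler_norm _) _.
    by rewrite normrM ler_piMr.
  apply: (@le_trans _ _ (\sum_(0 <= m < T') ((Af (a + m)%N - Af (a + m + r)%N) + dist (a + m) (a + m + r)))).
    by apply: ler_sum => m _.
  rewrite big_split /=.
  have s1 : \sum_(0 <= m < T') (Af (a + m)%N - Af (a + m + r)%N) <= 2 * r%:R.
    apply: le_trans (@sum_shift_le _ (fun m => Af (a + m)%N) T' r _) => //.
    by apply: ler_sum => m _; rewrite addnA.
  have s2 : \sum_(0 <= m < T') dist (a + m) (a + m + r) <= drift r r + 6 * r%:R.
    have -> : \sum_(0 <= m < T') dist (a + m) (a + m + r) =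
        \sum_(a <= n < a + T') dist n (n + r).
      by rewrite sum_nat_shift.
    have [TT|TT] := leqP T (T' - r); last first.
      apply: (@le_trans _ _ (2 * (a + T' - a)%:R)); first exact: sum_nat_le_cst.
      apply: (@le_trans _ _ (6 * r%:R)); last by rewrite lerDr sumr_ge0.
      by rewrite -!natrM ler_nat; lia.
    rewrite (@big_cat_nat _ _ _ T a (a + T')) /=; [|lia|lia].
    rewrite (@big_cat_nat _ _ _ (T' - r)%N T (a + T')) /=; [|lia|lia].
    rewrite -/(drift r r) addrCA lerD2l.
    have e1 : \sum_(a <= n < T) dist n (n + r) <= 2 * (T - a)%:R by exact: sum_nat_le_cst.
    have e2 : \sum_(T' - r <= n < a + T') dist n (n + r) <= 2 * (a + T' - (T' - r))%:R.
      exact: sum_nat_le_cst.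
    apply: le_trans (lerD e1 e2) _.
    by rewrite -!natrM -natrD ler_nat; lia.
  have := drift_close cv; move: s1 s2; rewrite [T'%:R * _]mulrC; lra.
apply: (@le_trans _ _ (avg (fun a : 'I_T => avg (fun y1 : H1 =>
   ((8 * M%:R + 4) * merr + 8 * r%:R / T'%:R) + 2 * err a y1)))).
  apply: ler_avg => a; apply: ler_avg => y1.
  apply: (@le_trans _ _ (avg (fun m : 'I_T' => X (a + m)%N + 2 * avg (fun y2 => gap a y1 m y2)))).
    apply: ler_avg => m.
    rewrite -avgMl -[X in X + _](avg_cst h2) -avgD.
    by apply: ler_avg => y2; exact: step1.
  rewrite avgD avgMl lerD2r; exact: step2.
under avg_eq => a do rewrite avgD (avg_cst h1) avgMl.
rewrite avgD (avg_cst (Ordinal T_gt0)) avgMl -/merr.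
by rewrite le_eqVlt; apply/orP; left; apply/eqP; ring.
Qed.

End ApproximatePeriod.

               

(** * Rounds, disclosed data and the energy potential *)

Section Rounds.
Context {Q Omega : finType} (F : Q -> Omega -> Q).

Fixpoint rounds (t : nat) : finType :=
  if t is t'.+1 then (Omega * rounds t')%type else unit.

Fixpoint run t : Q -> rounds t -> Q :=
  if t is t'.+1 then fun s p => run (F s p.1) p.2 else fun s _ => s.

Section RunLaw.
Context {R : realType} {U : eqType} (rev : Omega -> U).

Fixpoint revs t : rounds t -> seq U :=
  if t is t'.+1 then fun p => rev p.1 :: revs p.2 else fun=> [::].

                                                                       
(** The law of the final state from [s] when each remaining round is redrawn subject to its
    disclosed value; [p] enters only through [revs]. *)
Fixpoint law t : rounds t -> Q -> Q -> R :=
  if t is t'.+1 then fun p s o => condE rev (fun w => law p.2 (F s w) o) (rev p.1)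
  else fun _ s o => (s == o)%:R.

Lemma law_ge0 t (p : rounds t) s o : 0 <= law p s o.
Proof.
elim: t p s => [|t IH] p s /=; first by rewrite ler0n.
by rewrite /condE mulr_ge0 ?invr_ge0// sumr_ge0.
Qed.

Lemma law_sum t (p : rounds t) s : \sum_o law p s o = 1.
Proof.
elim: t p s => [|t IH] p s /=.
  rewrite (bigD1 s) //= eqxx big1 ?addr0// => o.
  by rewrite eq_sym => /negbTE->.
rewrite (condE_sum rev (fun w => law p.2 (F s w))) /condE.
under eq_bigr do rewrite IH.
by have := condE_cst rev (1 : R) p.1; rewrite /condE.
Qed.

Lemma avg_run t s (psi : seq U -> Q -> R) :
  avg (fun p : rounds t => psi (revs p) (run s p)) =
  avg (fun p : rounds t => \sum_o law p s o * psi (revs p) o).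
Proof.
elim: t s psi => [|t IH] s psi /=.
  apply: avg_eq => p; rewrite (bigD1 s) //= eqxx mul1r big1 ?addr0// => o.
  by rewrite eq_sym => /negbTE->; rewrite mul0r.
rewrite (avg_pair (fun w (p : rounds t) => psi (rev w :: revs p) (run (F s w) p))).
rewrite (avg_pair (fun w (p : rounds t) => \sum_o
  condE rev (fun w => law p (F s w) o) (rev w) * psi (rev w :: revs p) o)).
under avg_eq => w do rewrite (IH (F s w) (fun l => psi (rev w :: l))).
rewrite [LHS]avg_swap [RHS]avg_swap; apply: avg_eq => p.
rewrite !avg_sum; apply: eq_bigr => o _.
by rewrite (avg_condE rev (fun w => law p (F s w) o) (fun u => psi (u :: revs p) o)).
Qed.

(** The expected collision probability of the final state given the disclosed data; it is at most
    1. *)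
Definition energy t s : R := avg (fun p : rounds t => \sum_o law p s o ^+ 2).

(** How much the final law still depends on the current round beyond its disclosed value, in squared
    l2 norm; [forgetting1] is the l1 version. *)
Definition forgetting t s : R := avg (fun p : rounds t => avg (fun w =>
  \sum_o (law p (F s w) o - condE rev (fun w' => law p (F s w') o) (rev w)) ^+ 2)).

Definition forgetting1 t s : R := avg (fun p : rounds t => avg (fun w =>
  \sum_o `|law p (F s w) o - condE rev (fun w' => law p (F s w') o) (rev w)|)).

Lemma forgettingE t s :
  forgetting t s = avg (fun w => energy t (F s w)) - energy t.+1 s.
Proof.
rewrite /forgetting /energy /=.
rewrite (avg_pair (fun w (p : rounds t) => \sum_o
  condE rev (fun w => law p (F s w) o) (rev w) ^+ 2)).
rewrite (avg_swap (fun w (p : rounds t) => \sum_o law p (F s w) o ^+ 2)).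
rewrite (avg_swap (fun w (p : rounds t) => \sum_o condE rev _ (rev w) ^+ 2)) -avgB.
apply: avg_eq => p; rewrite !avg_sum -sumrB; apply: eq_bigr => o _.
exact: avg_sqr_condE.
Qed.

Lemma energy_ge0 t s : 0 <= energy t s.
Proof. by apply: avg_ge0 => p; apply: sumr_ge0 => o _; exact: sqr_ge0. Qed.

Definition Erun t (g : Q -> R) s : R := avg (fun p : rounds t => g (run s p)).

Lemma ErunS t g s : Erun t.+1 g s = avg (fun w => Erun t g (F s w)).
Proof. by rewrite /Erun /= (avg_pair (fun w (p : rounds t) => g (run (F s w) p))). Qed.

Lemma ErunSr t g s : Erun t.+1 g s = Erun t (fun s' => avg (fun w => g (F s' w))) s.
Proof.
elim: t s => [|t IH] s.
  by rewrite ErunS /Erun /= (avg_cst tt); apply: avg_eq => w; rewrite (avg_cst tt).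
by rewrite ErunS [RHS]ErunS; apply: avg_eq => w.
Qed.

Lemma rounds_inh (w0 : Omega) t : rounds t.
Proof. by elim: t => [|t IH] /=; [exact: tt|exact: (w0, IH)]. Qed.

Lemma Erun_le_affine (w0 : Omega) t (f g h : Q -> R) (c x y z : R) s :
  (forall s', f s' * x <= c + y * g s' + h s' * z) ->
  Erun t f s * x <= c + y * Erun t g s + Erun t h s * z.
Proof.
move=> fgh.
have := ler_avg (fun p : rounds t => fgh (run s p)).
by rewrite avgMr avgD avgD (avg_cst (rounds_inh w0 t)) avgMl avgMr.
Qed.

                                                                                     
(** Learning one more round in full raises the energy by exactly the forgetting of that round
    ([forgettingE]), so the sum telescopes inside [0, 1]. A random round thus has expected
    forgetting at most 1/tau. *)
Lemma sum_forgetting (w0 : Omega) (tau : nat) s :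
  \sum_(0 <= r < tau) Erun r (forgetting (tau.-1 - r)) s <= 1.
Proof.
pose G r := Erun r (energy (tau - r)) s.
rewrite (@telescope_sumr_eq _ 0 tau G) //; last first.
  move=> r /andP[_ rt].
  rewrite /G ErunSr -avgB; apply: avg_eq => p.
  rewrite forgettingE (_ : (tau - r.+1)%N = (tau.-1 - r)%N); last by lia.
  by rewrite (_ : (tau - r)%N = (tau.-1 - r).+1); last by lia.
have : 0 <= G 0%N by apply: avg_ge0 => p; exact: energy_ge0.
have : G tau <= 1.
  rewrite /G subnn; apply: (avg_le_cst (rounds_inh w0 tau)) => p.
  apply: (avg_le_cst tt) => q /=.
  rewrite (bigD1 (run s p)) //= eqxx expr1n big1 ?addr0// => o.
  by rewrite eq_sym => /negbTE->; rewrite expr0n.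
lra.
Qed.

(** From l2 to l1 over at most [M] states, with a free weight [gam] instead of a square root. *)
Lemma forgetting1_le (w0 : Omega) t s (M : nat) (gam : R) :
  (#|Q| <= M)%N -> 0 < gam ->
  forgetting1 t s <= (M%:R * gam + forgetting t s / gam) / 2.
Proof.
move=> QM g0.
have h (x : Q -> R) : \sum_o `|x o| <= (M%:R * gam + (\sum_o x o ^+ 2) / gam) / 2.
  apply: (@le_trans _ _ (\sum_o (gam + x o ^+ 2 / gam) / 2)).
    apply: ler_sum => o _; rewrite -(ler_pM2l g0).
    have -> : gam * ((gam + x o ^+ 2 / gam) / 2) = (gam ^+ 2 + `|x o| ^+ 2) / 2.
      by rewrite real_normK ?num_real//; field; rewrite gt_eqF.
    have : 0 <= (gam - `|x o|) ^+ 2 by exact: sqr_ge0.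
    by rewrite sqrrB; lra.
  rewrite -mulr_suml big_split /= sumr_const -mulr_suml ler_pM2r// lerD2r.
  by rewrite -[leLHS]mulr_natl ler_pM2r// ler_nat.
rewrite /forgetting1 /forgetting.
apply: (@le_trans _ _ (avg (fun p : rounds t => avg (fun w => (M%:R * gam +
   (\sum_o (law p (F s w) o - condE rev (fun w' => law p (F s w') o) (rev w)) ^+ 2) / gam) / 2)))).
  by apply: ler_avg => p; apply: ler_avg => w; exact: h.
under avg_eq => p do rewrite avgMr avgD (avg_cst w0) avgMr.
by rewrite avgMr avgD (avg_cst (rounds_inh w0 t)) avgMr.
Qed.

End RunLaw.
End Rounds.
Arguments rounds : clear implicits.

Lemma iter_eventually_periodic (Q : finType) (f : Q -> Q) (M : nat) (x : Q) :
  (#|Q| <= M)%N -> exists lam, (0 < lam <= M)%N /\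
  forall n, (M <= n)%N -> iter (n + lam) f x = iter n f x.
Proof.
move=> QM.
have ninj : ~ injective (fun i : 'I_M.+1 => iter i f x).
  by move=> /leq_card; rewrite card_ord ltnNge QM.
have [i [i' [lt e]]] : exists i i' : 'I_M.+1, (i < i')%N /\ iter i f x = iter i' f x.
  apply/not_existsP => nx; apply: ninj => i i' e.
  case: (ltngtP i i') => [lt|lt|/val_inj//]; exfalso.
    by apply: (nx i); exists i'.
  by apply: (nx i'); exists i.
exists (i' - i)%N; split; first by have := ltn_ord i'; lia.
move=> n Mn; have iM := ltn_ord i; have i'M := ltn_ord i'.
rewrite (_ : (n + (i' - i))%N = ((n - i) + i')%N); last by lia.
by rewrite iterD -e -iterD subnK//; lia.
Qed.

Section HalfRound.
Context {I Q : finType} (Fq : I -> Q -> Q).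

Definition half (c : I -> nat) (s : Q) : Q :=
  foldl (fun s q => iter (c q) (Fq q) s) s (enum I).

Lemma eq_half (c c' : I -> nat) s : c =1 c' -> half c s = half c' s.
Proof. by move=> e; rewrite /half; elim: (enum I) s => //= q l IH s; rewrite e IH. Qed.

(** Only the block [j] sees the changed count, and [base >= M] repetitions already put its orbit on
    a cycle. *)
Lemma half_periodic (j : I) (M base : nat) (c : I -> nat) s :
  (#|Q| <= M)%N -> (M <= base)%N ->
  exists lam, (0 < lam <= M)%N /\
  forall a, half (fun q => base + if q == j then a + lam else c q)%N s =
            half (fun q => base + if q == j then a else c q)%N s.
Proof.
move=> QM Mb; rewrite /half.
have := enum_uniq I; have : j \in enum I by rewrite mem_enum.
case/splitPr => e1 e2; rewrite cat_uniq /= => /and3P[_ /norP[je1 _] /andP[je2 _]].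
have ext (e : seq I) a x : j \notin e ->
   foldl (fun s q => iter (base + if q == j then a else c q)%N (Fq q) s) x e =
   foldl (fun s q => iter (base + c q)%N (Fq q) s) x e.
  elim: e x => //= q e IH x; rewrite inE negb_or => /andP[jq je].
  by rewrite eq_sym (negbTE jq) IH.
set x := foldl (fun s q => iter (base + c q)%N (Fq q) s) s e1.
have [lam [lamM per]] := iter_eventually_periodic (Fq j) x QM.
exists lam; split=> // a; rewrite !foldl_cat /= !eqxx !ext// -/x addnA per//.
exact: leq_trans Mb (leq_addr _ _).
Qed.

End HalfRound.

                                                                                    
                                                                                       
(** * A round with two phases *)

Section TwoPhaseRound.
Context {R : realType} {I Q : finType} (Fq : I -> Q -> Q).
Variables (M base Lm T' : nat).
Hypotheses (QM : (#|Q| <= M)%N) (Mbase : (M <= base)%N) (T'_gt0 : (0 < T')%N).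

Local Notation r := (Lm`!).
Local Notation T := ((Lm`!).*2).

Definition Omega : finType := ({ffun I -> 'I_T} * {ffun I -> 'I_T'})%type.

Definition round_step (s : Q) (w : Omega) : Q :=
  half Fq (fun q => w.2 q : nat) (half Fq (fun q => base + w.1 q)%N s).

Fixpoint totals t : rounds Omega t -> I -> nat :=
  if t is t'.+1 then fun p q => ((base + p.1.1 q + p.1.2 q) + totals p.2 q)%N
  else fun _ _ => 0%N.

(** The value 0 outside [X] hides those entries. *)
Definition known (X : {set I}) (f : I -> nat) : {ffun I -> nat} :=
  [ffun q => if q \in X then f q else 0%N].

Variables (j : I) (X : {set I}).
Hypothesis jX : j \notin X.

(** Both phases are disclosed on [X], but for [j] only their sum: this lets a larger first-phase
    count be compensated in the second phase. *)
Definition reveal (w : Omega) : {ffun I -> nat} * {ffun I -> nat} * nat :=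
  (known X (fun q => w.1 q : nat), known X (fun q => w.2 q : nat), (w.1 j + w.2 j)%N).

Definition cnt N (kx : {ffun I -> nat}) (a : nat) (y : {ffun I -> 'I_N}) (q : I) : nat :=
  if q == j then a else if q \in X then kx q else y q.

Definition mid_state s (kx : {ffun I -> nat}) (a : nat) (y : {ffun I -> 'I_T}) : Q :=
  half Fq (fun q => base + cnt kx a y q)%N s.

Definition end_law t (p : rounds Omega t) (kx : {ffun I -> nat}) (u : Q) (m : nat)
    (y : {ffun I -> 'I_T'}) (o : Q) : R :=
  law round_step reveal p (half Fq (cnt kx m y) u) o.

Definition mean_law t (p : rounds Omega t) s (kx kx2 : {ffun I -> nat}) (n : nat) (o : Q) : R :=
  condE reveal (fun w => law round_step reveal p (round_step s w) o) (kx, kx2, n).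

Definition kn N (f : {ffun I -> 'I_N}) := known X (fun q => f q : nat).

Lemma kn_merge N (f g : {ffun I -> 'I_N}) : kn (merge (j |: X) f g) = kn f.
Proof. by apply/ffunP => q; rewrite !ffunE !inE; case: ifP => // ->; rewrite orbT. Qed.

Let mg N (f y : {ffun I -> 'I_N}) (a : 'I_N) := merge X f (upd y j a).

Lemma mgE N (f y : {ffun I -> 'I_N}) (a : 'I_N) q : (mg f y a q : nat) = cnt (kn f) a y q.
Proof.
rewrite /cnt !ffunE; case: (eqVneq q j) => [->|_]; first by rewrite (negbTE jX).
by case: ifP.
Qed.

Lemma avg_context N (n0 : 'I_N) (G : {ffun I -> 'I_N} -> R) :
  avg (fun f => avg (fun a => avg (fun y => G (mg f y a)))) = avg G.
Proof.
rewrite -(avg_merge X G); apply: avg_eq => f.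
by rewrite -(avg_upd j n0 (fun g => G (merge X f g))).
Qed.

Lemma round_step_mg s i0 y a m0 y2 m :
  round_step s (mg i0 y a, mg m0 y2 m) =
  half Fq (cnt (kn m0) m y2) (mid_state s (kn i0) a y).
Proof.
rewrite /round_step /mid_state /=; have -> : half Fq (fun q => base + mg i0 y a q)%N s =
   half Fq (fun q => base + cnt (kn i0) a y q)%N s.
  by apply: eq_half => q; rewrite mgE.
by apply: eq_half => q; rewrite mgE.
Qed.

Lemma reveal_mg i0 y a m0 y2 m :
  reveal (mg i0 y a, mg m0 y2 m) = (kn i0, kn m0, (a + m)%N).
Proof.
rewrite /reveal /=; congr (_, _, _).
- by apply/ffunP => q; rewrite !ffunE; case: ifP => // qX; rewrite qX.
- by apply/ffunP => q; rewrite !ffunE; case: ifP => // qX; rewrite qX.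
- by rewrite !mgE /cnt eqxx.
Qed.

Definition cmerr t (p : rounds Omega t) s kx kx2 :=
  merr Lm T' (mid_state s kx) (end_law p kx2) (mean_law p s kx kx2).

Definition cclose t (p : rounds Omega t) s kx kx2 :=
  close_visits Lm T' (mid_state s kx) (end_law p kx2) (mean_law p s kx kx2).

Let T_gt0 : (0 < T)%N. Proof. by rewrite double_gt0 fact_gt0. Qed.
Let t0 : 'I_T := Ordinal T_gt0.
Let t0' : 'I_T' := Ordinal T'_gt0.
Let f0 : {ffun I -> 'I_T} := [ffun=> t0].
Let f0' : {ffun I -> 'I_T'} := [ffun=> t0'].

Lemma avg_round (G : Omega -> R) :
  avg (fun i0 => avg (fun m0 => avg (fun a => avg (fun y => avg (fun m => avg (fun y2 =>
    G (mg i0 y a, mg m0 y2 m))))))) = avg G.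
Proof.
rewrite [RHS]avg_pairE.
rewrite -(avg_context t0 (fun i => avg (fun m => G (i, m)))).
apply: avg_eq => i0; rewrite avg_swap; apply: avg_eq => a.
rewrite avg_swap; apply: avg_eq => y.
by rewrite -(avg_context t0' (fun m => G (mg i0 y a, m))).
Qed.

(** Links the two error notions: for each disclosed context on [X], [merr] is the l1 deviation from
    the law given the sum, and averaging over contexts yields [forgetting1]. *)
Lemma avg_cmerr t s : avg (fun p : rounds Omega t => avg (fun i0 : {ffun I -> 'I_T} =>
  avg (fun m0 : {ffun I -> 'I_T'} => cmerr p s (kn i0) (kn m0)))) = forgetting1 round_step reveal t s.
Proof.
rewrite /forgetting1; apply: avg_eq => p.
rewrite -[RHS]avg_round; apply: avg_eq => i0; apply: avg_eq => m0.
rewrite /cmerr /merr; apply: avg_eq => a; apply: avg_eq => y.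
rewrite /err; apply: avg_eq => m; apply: avg_eq => y2.
rewrite /gap; apply: eq_bigr => o _.
by rewrite /end_law round_step_mg reveal_mg.
Qed.

Lemma mid_state_periodic s kx y : exists lam, (0 < lam <= M)%N /\
  forall a, mid_state s kx (a + lam)%N y = mid_state s kx a y.
Proof.
exact: (@half_periodic _ _ Fq j M base (fun q => if q \in X then kx q else y q) s).
Qed.

Lemma mean_law_le1 t (p : rounds Omega t) s kx kx2 n :
  \sum_o `|mean_law p s kx kx2 n o| <= 1.
Proof.
apply: (@le_trans _ _ (\sum_o mean_law p s kx kx2 n o)).
  apply: ler_sum => o _; rewrite ger0_norm// /mean_law /condE.
  by rewrite mulr_ge0 ?invr_ge0// sumr_ge0// => w _; exact: law_ge0.
rewrite /mean_law condE_sum; apply: le_trans (ler_norm _) _.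
by apply: condE_norm_le1 => w; rewrite law_sum normr1.
Qed.

(** Probability that no close coincidence of middle states exists. *)
Definition pbad t s : R := avg (fun p : rounds Omega t => avg (fun m0 : {ffun I -> 'I_T'} =>
  avg (fun i0 : {ffun I -> 'I_T} => (~~ cclose p s (kn i0) (kn m0))%:R))).

(** [shift_unnoticed] on contexts with a coincidence, the trivial bound 2 on the others. *)
Lemma round_shift t s (phi : rounds Omega t -> Q -> {ffun I -> nat} * {ffun I -> nat} * nat -> R) :
  (forall p o u, `|phi p o u| <= 1) ->
  avg (fun p : rounds Omega t => avg (fun w => \sum_o law round_step reveal p (round_step s w) o *
    (phi p o (reveal w) - phi p o ((reveal w).1, ((reveal w).2 + r)%N))))
  <= (8 * M%:R + 6) * forgetting1 round_step reveal t s + 8 * r%:R / T'%:R + 2 * pbad t s.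
Proof.
move=> phi1.
have h p i0 m0 : avg (fun a => avg (fun y => avg (fun m => avg (fun y2 =>
   (fun w => \sum_o law round_step reveal p (round_step s w) o *
    (phi p o (reveal w) - phi p o ((reveal w).1, ((reveal w).2 + r)%N))) (mg i0 y a, mg m0 y2 m)))))
   <= (8 * M%:R + 6) * cmerr p s (kn i0) (kn m0) + 8 * r%:R / T'%:R
      + 2 * (~~ cclose p s (kn i0) (kn m0))%:R.
  have [cl|ncl] := boolP (cclose p s (kn i0) (kn m0)); last first.
    apply: (@le_trans _ _ 2).
      apply: (avg_le_cst t0) => a; apply: (avg_le_cst f0) => y.
      apply: (avg_le_cst t0') => m; apply: (avg_le_cst f0') => y2.
      set w := (_, _).
      apply: (@le_trans _ _ (\sum_o law round_step reveal p (round_step s w) o * 2)).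
        apply: ler_sum => o _; apply: ler_wpM2l; first exact: law_ge0.
        have := phi1 p o (reveal w); have := phi1 p o ((reveal w).1, ((reveal w).2 + r)%N).
        by rewrite !ler_norml; lra.
      by rewrite -mulr_suml law_sum mul1r.
    rewrite mulr1 lerDr; apply: addr_ge0; last by rewrite divr_ge0 ?mulr_ge0.
    by apply: mulr_ge0; [rewrite addr_ge0 ?mulr_ge0|exact: merr_ge0].
  rewrite mulr0 addr0.
  have := @shift_unnoticed R Q _ _ f0 f0' M Lm T' (mid_state s (kn i0)) (end_law p (kn m0))
     (mean_law p s (kn i0) (kn m0)) T'_gt0 (mid_state_periodic s (kn i0))
     (mean_law_le1 p s (kn i0) (kn m0)) (fun o n => phi p o (kn i0, kn m0, n)) _ cl.
  move=> /(_ (fun o n => phi1 p o _)); apply: le_trans.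
  rewrite le_eqVlt; apply/orP; left; apply/eqP.
  apply: avg_eq => a; apply: avg_eq => y; apply: avg_eq => m; apply: avg_eq => y2.
  apply: eq_bigr => o _.
  by rewrite round_step_mg reveal_mg.
rewrite -avg_cmerr /pbad.
under avg_eq => p do rewrite -avg_round.
under [X in _ + 2 * X]avg_eq => p do rewrite avg_swap.
apply: (@le_trans _ _ (avg (fun p : rounds Omega t => avg (fun i0 : {ffun I -> 'I_T} => avg (fun m0 : {ffun I -> 'I_T'} =>
  (8 * M%:R + 6) * cmerr p s (kn i0) (kn m0) + 8 * r%:R / T'%:R
      + 2 * (~~ cclose p s (kn i0) (kn m0))%:R))))).
  by apply: ler_avg => p; apply: ler_avg => i0; apply: ler_avg => m0; exact: h.
under avg_eq => p do under avg_eq => i0 do rewrite avgD avgD avgMl avgMl (avg_cst f0').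
under avg_eq => p do rewrite avgD avgD avgMl avgMl (avg_cst f0).
by rewrite avgD avgD avgMl avgMl (avg_cst (rounds_inh (f0, f0') t)).
Qed.

Definition mid_of s (i : {ffun I -> 'I_T}) : Q := half Fq (fun q => base + i q)%N s.

Lemma mid_of_mg s i0 y a : mid_of s (mg i0 y a) = mid_state s (kn i0) a y.
Proof. by apply: eq_half => q; rewrite mgE. Qed.

(** In a bad context the middle state is visited by at most a 2/[Lm] fraction of the counts of [j],
    so it nearly determines the count up to that fraction and carries about ln [Lm] nats. *)
Lemma pbad_le t s : (0 < Lm)%N ->
  pbad t s * (3 / 4 * ln Lm%:R - 2) <=
  centropy (mid_of s) X - centropy (mid_of s) (j |: X) :> R.
Proof.
move=> Lm0.
have Lm0' : 0 < Lm%:R :> R by rewrite ltr0n.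
have lnL : 0 <= ln Lm%:R :> R by rewrite ln_ge0// ler1n.
rewrite /pbad -avgMr; apply: (avg_le_cst (rounds_inh (f0, f0') t)) => p.
rewrite -avgMr; apply: (avg_le_cst f0') => m0.
pose cl (i : {ffun I -> 'I_T}) := cclose p s (kn i) (kn m0).
pose vis (i : {ffun I -> 'I_T}) := visits Lm T' (mid_state s (kn i)) (end_law p (kn m0)) (mean_law p s (kn i) (kn m0)).
(* The test function bets a factor [Lm] on the event that the actual count visits the middle
   state. *)
pose G (i : {ffun I -> 'I_T}) v0 : R := if ~~ cl i && vis i v0 (i j) then Lm%:R else 1.
have G0 i v0 : 0 < G i v0 by rewrite /G; case: ifP.
have GX i g v0 : G (merge (j |: X) i g) v0 = G i v0.
  by rewrite /G /cl /vis !kn_merge ffunE !inE eqxx.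
have knmg (i y : {ffun I -> 'I_T}) a : kn (mg i y a) = kn i.
  by apply/ffunP => q; rewrite !ffunE; case: ifP => // qX; rewrite qX.
have mgj i y (a : 'I_T) : mg i y a j = a.
  by rewrite /mg !ffunE (negbTE jX) eqxx.
apply: le_trans (centropy_gain (mid_of s) f0 G0 GX).
(* By [err_mass] the bet is won with probability at least 3/4 in a bad context. *)
have lower : avg (fun i => (~~ cl i)%:R * (3 / 4 * ln Lm%:R)) <= avg (fun i => ln (G i (mid_of s i))).
  rewrite -(avg_context t0 (fun i => ln (G i (mid_of s i)))); apply: ler_avg => i.
  have [c|nc] := boolP (cl i).
    rewrite mul0r; apply: avg_ge0 => a; apply: avg_ge0 => y.
    by rewrite /G /cl knmg -/(cl i) c /= ln1.
  rewrite mul1r.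
  apply: (@le_trans _ _ (avg (fun a : 'I_T => avg (fun y =>
     (err T' (mid_state s (kn i)) (end_law p (kn m0)) (mean_law p s (kn i) (kn m0)) a y
       <= 4 * cmerr p s (kn i) (kn m0))%R%:R * ln Lm%:R)))).
    under avg_eq => a do rewrite avgMr.
    rewrite avgMr ler_wpM2r//.
    exact: (err_mass f0).
  apply: ler_avg => a; apply: ler_avg => y.
  rewrite /G /cl /vis knmg -/(cl i) nc /= mgj mid_of_mg.
  case: (boolP (err _ _ _ _ _ _ <= _)) => he; last by rewrite mul0r; case: ifP => _; rewrite ?ln1.
  rewrite mul1r ifT//; apply/existsP; exists y; rewrite eqxx /=.
  exact: he.
(* For a middle state drawn independently of the count, sparsity of visits bounds the payoff by 1 +
   2. *)
have upper : avg (fun i => avg (fun g => G i (mid_of s (merge X i g)))) <=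
    1 + avg (fun i => (~~ cl i)%:R * 2).
  rewrite -(avg_upd j t0) avg_swap -[X in X + _](avg_cst f0) -avgD; apply: ler_avg => i.
  rewrite avg_swap; apply: (avg_le_cst f0) => g.
  have e a : merge X (upd i j a) g = merge X i g.
    apply/ffunP => q; rewrite !ffunE; case: ifP => // qX; rewrite ifN//.
    by apply: contraNneq jX => <-.
  have ek a : kn (upd i j a) = kn i.
    apply/ffunP => q; rewrite !ffunE; case: ifP => // qX; rewrite ifN//.
    by apply: contraNneq jX => <-.
  have [c|nc] := boolP (cl i).
    rewrite mul0r addr0; apply: (avg_le_cst t0) => a.
    by rewrite /G /cl ek -/(cl i) c.
  rewrite mul1r.
  have sp := visits_sparse (mid_of s (merge X i g)) nc.
  apply: (@le_trans _ _ (avg (fun a : 'I_T => 1 + Lm%:R * (vis i (mid_of s (merge X i g)) a)%:R))).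
    apply: ler_avg => a; rewrite /G /cl /vis ek -/(cl i) nc e ffunE eqxx /= -/(vis i).
    case: ifP => _; first by rewrite mulr1 lerDr.
    by rewrite mulr0 addr0.
  rewrite avgD (avg_cst t0) lerD2l avgMl; exact: sp.
move: lower upper; rewrite !avgMr mulrBr; lra.
Qed.

End TwoPhaseRound.

                               

(** * Shifting one total over all rounds *)

Section ShiftedTotals.
Context {R : realType} {I Q : finType} (Fq : I -> Q -> Q).
Variables (M base Lm T' : nat).
Hypotheses (QM : (#|Q| <= M)%N) (Mbase : (M <= base)%N) (T'_gt0 : (0 < T')%N).
Variables (j : I) (X : {set I}).
Hypothesis jX : j \notin X.

Local Notation Om := (@Omega I Lm T').
Local Notation step := (@round_step I Q Fq base Lm T').
Local Notation rv := (@reveal I Lm T' j X).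

Definition revealed_total (u : {ffun I -> nat} * {ffun I -> nat} * nat) (q : I) : nat :=
  (base + if q == j then u.2 else u.1.1 q + u.1.2 q)%N.

Definition revealed_totals l (q : I) : nat := (\sum_(u <- l) revealed_total u q)%N.

Lemma revealed_totalE (w : Om) q : q \in j |: X ->
  (base + w.1 q + w.2 q)%N = revealed_total (rv w) q.
Proof.
rewrite !inE /revealed_total /= -addnA; case: eqP => [->//|_ /= qX].
by rewrite !ffunE qX.
Qed.

Lemma revealed_totalsE t (p : rounds Om t) q : q \in j |: X ->
  totals base p q = revealed_totals (revs rv p) q.
Proof.
move=> qX; elim: t p => [|t IH] p /=; first by rewrite /revealed_totals big_nil.
by rewrite /revealed_totals big_cons IH -revealed_totalE.
Qed.

Definition shift_bound t s : R :=
  (8 * M%:R + 6) * forgetting1 step rv t s + 8 * (Lm`!)%:R / T'%:R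
  + 2 * pbad Fq base Lm T' j X t s.

(** An observer who holds the final state and the totals on [j |: X] hardly notices a shift of the
    total of [j] by [Lm!]: on these blocks the totals are functions of the disclosed data. *)
Lemma totals_shift_unnoticed (r t : nat) (s0 : Q) (phi : Q -> {ffun I -> nat} -> R) :
  (forall o g, `|phi o g| <= 1) ->
  avg (fun pre : rounds Om r => avg (fun w : Om => avg (fun post : rounds Om t =>
    phi (run step (step (run step s0 pre) w) post) (known (j |: X) (fun q =>
      totals base pre q + ((base + w.1 q + w.2 q) + totals base post q))%N)
    - phi (run step (step (run step s0 pre) w) post) (known (j |: X) (fun q =>
      totals base pre q + ((base + w.1 q + w.2 q) + totals base post q)
      + Lm`! * (q == j))%N))))
  <= Erun step r (shift_bound t) s0.
Proof.
move=> phi1; apply: ler_avg => pre.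
set s := run step s0 pre.
pose K u l (e : nat) : {ffun I -> nat} := known (j |: X) (fun q =>
  totals base pre q + (revealed_total u q + revealed_totals l q) + e * (q == j))%N.
have K0 (w : Om) (post : rounds Om t) : known (j |: X) (fun q =>
      totals base pre q + ((base + w.1 q + w.2 q) + totals base post q))%N =
    K (rv w) (revs rv post) 0%N.
  apply/ffunP => q; rewrite !ffunE; case: ifP => // qX.
  by rewrite revealed_totalE// (revealed_totalsE post qX) mul0n addn0.
have Kr (w : Om) (post : rounds Om t) : known (j |: X) (fun q =>
      totals base pre q + ((base + w.1 q + w.2 q) + totals base post q)
      + Lm`! * (q == j))%N =
    K (rv w) (revs rv post) (Lm`!).
  by apply/ffunP => q; rewrite !ffunE; case: ifP => // qX;
     rewrite revealed_totalE// (revealed_totalsE post qX).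
(* The shift can be charged to the disclosed sum of the single round [w], where [round_shift]
   applies. *)
have Ks u l : K u l (Lm`!) = K (u.1, (u.2 + Lm`!)%N) l 0%N.
  apply/ffunP => q; rewrite !ffunE; case: ifP => // qX.
  by rewrite /revealed_total /=; case: eqP => _; lia.
have := @round_shift R I Q Fq M base Lm T' QM Mbase T'_gt0 j X jX t s
  (fun post o u => phi o (K u (revs rv post) 0%N)) (fun _ _ _ => phi1 _ _).
apply: le_trans; rewrite le_eqVlt; apply/orP; left; apply/eqP.
rewrite [RHS]avg_swap; apply: avg_eq => w.
under avg_eq => post do rewrite K0 Kr Ks.
exact: (avg_run step rv t (step s w) (fun l o => phi o (K (rv w) l 0%N)
  - phi o (K ((rv w).1, ((rv w).2 + Lm`!)%N) l 0%N))).
Qed.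

End ShiftedTotals.

                                                                                 
                                                                        
(** * Multiplicities as unit update streams *)

Section Words.
Context {n L k : nat}.
Local Notation I := ('I_L * 'I_k)%type.
Variable emb : {q : I & 'I_(2 ^ q.1)} -> 'I_n.
Hypothesis emb_inj : injective emb.

Definition block (z : int) (q : I) : stream n :=
  [seq (emb (existT _ q t), z) | t <- enum 'I_(2 ^ q.1)].

Definition word (z : int) (c : I -> nat) : stream n :=
  flatten [seq flatten (nseq (c q) (block z q)) | q <- enum {: I}].

Definition weight (c : I -> nat) : nat := (\sum_(q : I) c q * 2 ^ q.1)%N.

Lemma size_word z c : size (word z c) = weight c.
Proof.
rewrite /weight -big_enum /word /=; elim: (enum _) => [|q l IH] /=; first by rewrite big_nil.
rewrite big_cons size_cat IH size_flatten /shape map_nseq sumn_nseq size_map size_enum_ord.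
by rewrite mulnC.
Qed.

Lemma unit_word z c : (z == 1) || (z == -1) -> unit_update_stream (word z c).
Proof.
move=> hz; rewrite /unit_update_stream; apply/allP => u /flattenP[l /mapP[q _ ->]].
by move=> /flattenP[l' /nseqP[-> _] /mapP[t _ ->]].
Qed.

Lemma frequency_cat (s1 s2 : stream n) :
  frequency_vector (s1 ++ s2) = frequency_vector s1 + frequency_vector s2.
Proof. by rewrite /frequency_vector big_cat. Qed.

Lemma frequency_nil : frequency_vector ([::] : stream n) = 0.
Proof. by rewrite /frequency_vector big_nil. Qed.

Lemma frequency_flatten (ss : seq (stream n)) :
  frequency_vector (flatten ss) = \sum_(s <- ss) frequency_vector s.
Proof.
elim: ss => [|s ss IH] /=; first by rewrite big_nil frequency_nil.
by rewrite frequency_cat big_cons IH.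
Qed.

Definition lift_vec (d : I -> int) : 'rV[int]_n :=
  \sum_(q : I) \sum_(t < 2 ^ q.1) d q *: delta_mx 0 (emb (existT _ q t)).

Lemma frequency_word z c : frequency_vector (word z c) = lift_vec (fun q => z *+ c q).
Proof.
rewrite /word frequency_flatten big_map big_enum /lift_vec /=; apply: eq_bigr => q _.
rewrite frequency_flatten big_nseq iter_addr_0.
have -> : frequency_vector (block z q) = \sum_(t < 2 ^ q.1) z *: delta_mx 0 (emb (existT _ q t)).
  by rewrite /frequency_vector big_map big_enum.
rewrite -sumrMnl; apply: eq_bigr => t _.
by rewrite scalerMnl.
Qed.

Lemma lift_vecD d d' : lift_vec d + lift_vec d' = lift_vec (fun q => d q + d' q).
Proof.
rewrite /lift_vec -big_split; apply: eq_bigr => q _ /=.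
by rewrite -big_split; apply: eq_bigr => t _ /=; rewrite scalerDl.
Qed.

Lemma lift_vecE d (c : 'I_n) : lift_vec d ord0 c =
  \sum_(p : {q : I & 'I_(2 ^ q.1)}) d (tag p) * (c == emb p)%:R.
Proof.
rewrite /lift_vec summxE.
transitivity (\sum_(q : I) \sum_(t < 2 ^ q.1) d q * (c == emb (existT _ q t))%:R).
  apply: eq_bigr => q _; rewrite summxE; apply: eq_bigr => t _.
  by rewrite !mxE eqxx.
by rewrite sig_big_dep /=; apply: eq_bigr => -[q t].
Qed.

Lemma lift_vec_emb d p : lift_vec d ord0 (emb p) = d (tag p).
Proof.
rewrite lift_vecE (bigD1 p) //= eqxx mulr1 big1 ?addr0// => p' ne.
by rewrite (inj_eq emb_inj) eq_sym (negbTE ne) mulr0.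
Qed.

Lemma L0norm_lift d : L0norm (lift_vec d) = weight (fun q => d q != 0).
Proof.
rewrite /L0norm.
have -> : [set i | lift_vec d ord0 i != 0]%SET =
   (emb @: [set p : {q : I & 'I_(2 ^ q.1)} | d (tag p) != 0]%SET)%SET.
  apply/setP => c; rewrite inE; apply/idP/imsetP => [h|[p]].
    have [[p cp]|np] := pselect (exists p, c = emb p); last first.
      move: h; rewrite lift_vecE big1 ?eqxx// => p _.
      by case: eqP => [cp|_]; [case: np; exists p|rewrite mulr0].
    by exists p => //; rewrite inE -lift_vec_emb -cp.
  by rewrite inE => h ->; rewrite lift_vec_emb.
rewrite card_imset// -sum1_card /weight.
transitivity (\sum_(q : I | d q != 0) \sum_(t < 2 ^ q.1) 1)%N.
  by rewrite sig_big_dep /=; apply: eq_bigl => -[q t]; rewrite inE andbT.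
rewrite big_mkcond /=; apply: eq_bigr => q _; rewrite sum1_card card_ord.
by case: (d q != 0); rewrite ?mul1n ?mul0n.
Qed.

(** On such streams the algorithm is an automaton iterating one map per block, as in [half]. *)
Lemma foldl_word (Q : finType) (f : Q -> update n -> Q) (z : int) c s :
  foldl f s (word z c) = half (fun q s => foldl f s (block z q)) c s.
Proof.
rewrite /word /half; elim: (enum _) s => //= q l IH s.
rewrite foldl_cat IH; congr foldl.
elim: (c q) s => //= m IHm s; rewrite foldl_cat IHm.
by rewrite -iterSr iterS.
Qed.

End Words.

                                   

(** * The one-way protocol *)

Lemma level_setE (L k : nat) (l : 'I_L) :
  [set q : 'I_L * 'I_k | q.1 == l]%SET = ((fun p : 'I_k => (l, p)) @: [set: 'I_k])%SET.
Proof.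
apply/setP => -[l' p]; rewrite !inE /=; apply/eqP/imsetP => [->|[p' _ [-> _]]//].
by exists p; rewrite ?inE.
Qed.

Lemma level_set_card (L k : nat) (l : 'I_L) :
  #|[set q : 'I_L * 'I_k | q.1 == l]%SET| = k.
Proof. by rewrite level_setE card_imset ?cardsT ?card_ord// => p p' []. Qed.

                                                                                    
                                                                                  
                                                                                     
                                                              
Section Protocol.
Context {R : realType} {n L k : nat}.
Local Notation I := ('I_L * 'I_k)%type.
Local Notation bits := {ffun I -> bool}.
Variable emb : {q : I & 'I_(2 ^ q.1)} -> 'I_n.
Hypothesis emb_inj : injective emb.
Variables (A : det_algorithm R n) (eps : R) (ell : 'I_L) (J : {set I}).
Hypotheses (J_level : forall q, q \in J -> q.1 = ell) (kJ : (k <= 2 * #|J|)%N).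
Hypotheses (k_gt0 : (0 < k)%N) (eps_ge0 : 0 <= eps) (epsk : (500 * eps) ^+ 2 * k%:R <= 1).
Context {Om : finType} {D : eqType} (w0 : Om).
Variables (al : Om -> bits -> stream n) (tot : Om -> bits -> I -> nat).
Variables (dat : Om -> bits -> D) (bc : D -> bits -> I -> nat).
Hypothesis al_tot : forall w b, frequency_vector (al w b) = frequency_vector (word emb 1 (tot w b)).
Hypothesis tot_high : forall w b y (q : I), (ell < q.1)%N -> tot w b q = bc (dat w b) y q.
Hypothesis tot_low : forall w b y (q : I), (q.1 <= ell)%N -> q \notin J ->
  tot w b q != bc (dat w b) y q.
Hypothesis tot_J : forall w b y (q : I), q \in J ->
  (tot w b q == bc (dat w b) y q) = (b q == y q).

(** [al] is Alice's stream with multiplicities [tot], [dat] the side information she sends, and [bc]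
    what Bob deletes given this information and his guess [y]. *)
Definition protocol_stream w b y : stream n := al w b ++ word emb (-1) (bc (dat w b) y).

Lemma sum_levels_below : (\sum_(q : I | q.1 < ell) 2 ^ q.1 + k = k * 2 ^ ell)%N.
Proof.
have -> : (\sum_(q : I | q.1 < ell) 2 ^ q.1 = \sum_(l < L | l < ell) \sum_(p < k) 2 ^ l)%N.
  by rewrite pair_big /=; apply: eq_bigl => q; rewrite andbT.
under eq_bigr => l _ do rewrite sum_nat_const card_ord.
rewrite -big_distrr /= -(big_ord_widen L (fun i => 2 ^ i)%N (ltnW (ltn_ord ell))).
have := predn_exp 2 ell; rewrite mul1n => <-.
have : (0 < 2 ^ ell)%N by rewrite expn_gt0.
by case: (2 ^ ell)%N => // m _; rewrite mulnS addnC.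
Qed.

Lemma sum_level w b y : (\sum_(q : I | q.1 == ell) (tot w b q != bc (dat w b) y q) + #|J|
  = k + \sum_(q in J) (b q != y q))%N.
Proof.
pose Lv := [set q : I | q.1 == ell]%SET.
have cLv : #|Lv| = k by exact: level_set_card.
have JL : J \subset Lv.
  by apply/fintype.subsetP => q /J_level e; rewrite inE e.
rewrite (eq_bigl (fun q => q \in Lv)); last by move=> q; rewrite inE.
rewrite (big_setID J) /= (finset.setIidPr JL).
rewrite (eq_bigr (fun q => (b q != y q) : nat)); last by move=> q qJ; rewrite tot_J.
rewrite [X in (_ + X + _)%N](eq_bigr (fun=> 1%N)); last first.
  move=> q; rewrite !inE => /andP[qJ /eqP qe]; rewrite tot_low// qe//.
rewrite sum1_card cardsD (finset.setIidPr JL) cLv -addnA subnK 1?addnC//.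
by have := subset_leq_card JL; rewrite cLv.
Qed.

Definition midpoint : R := (2 ^ ell)%:R * (2 * k%:R - #|J|%:R / 2) - k%:R.

(** Levels above [ell] cancel and levels below survive entirely. On level [ell] the blocks off [J]
    survive, and those in [J] exactly where [b] and [y] differ, which is a Hamming distance. *)
Lemma L0norm_protocol w b y :
  (L0norm (frequency_vector (protocol_stream w b y)))%:R =
  midpoint - (2 ^ ell)%:R * corr J b y / 2.
Proof.
rewrite /protocol_stream frequency_cat al_tot !frequency_word lift_vecD L0norm_lift//.
have -> : weight (fun q : I => (1%:Z *+ tot w b q + -1 *+ bc (dat w b) y q != 0) : bool) =
    (\sum_(q : I | (q.1 < ell)%N) 2 ^ q.1 +
     (\sum_(q : I | q.1 == ell) (tot w b q != bc (dat w b) y q)) * 2 ^ ell)%N.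
  rewrite /weight (bigID (fun q : I => (q.1 < ell)%N)) /=; congr addn.
    apply: eq_bigr => q lt; rewrite mulNrn subr_eq0 eqr_nat.
    have qJ : q \notin J by apply/negP => /J_level e; rewrite e ltnn in lt.
    by rewrite (tot_low _ _ _ (ltnW lt))// mul1n.
  rewrite big_distrl /= [RHS]big_mkcond [LHS]big_mkcond /=; apply: eq_bigr => q _.
  rewrite mulNrn subr_eq0 eqr_nat; case: ltngtP => [lt|gt|e] /=.
  - by case: eqP lt => // ->; rewrite ltnn.
  - by rewrite (tot_high w b y gt) eqxx mul0n; case: eqP.
  - by rewrite (val_inj e) eqxx.
have h1 := sum_levels_below; have h2 := sum_level w b y.
have -> : corr J b y = #|J|%:R - 2 * (\sum_(q in J) (b q != y q))%N%:R :> R.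
  rewrite natr_sum mulr_sumr -sum1_card natr_sum -sumrB; apply: eq_bigr => q _.
  by rewrite /sg; case: (b q); case: (y q); rewrite /= ?expr0 ?expr1; ring.
move/(congr1 (fun x => x%:R : R)): h1; move/(congr1 (fun x => x%:R : R)): h2.
rewrite !natrD !natrM /midpoint; set S1 := (\sum_(q | _ == _) _)%N; set S0 := (\sum_(q | _ < _) _)%N.
set N := (\sum_(q in J) _)%N => h2 h1.
have -> : S1%:R = k%:R + N%:R - #|J|%:R :> R by rewrite -h2; ring.
have -> : S0%:R = k%:R * (2 ^ ell)%:R - k%:R :> R by rewrite -h1; ring.
by field.
Qed.

Definition success w b y : bool :=
  `[< approximates eps (frequency_vector (protocol_stream w b y))
        (output A (protocol_stream w b y)) >].

Definition message w b : memory A * D :=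
  (foldl (@process R n A) (@initial R n A) (al w b), dat w b).

Definition decision (u : memory A * D) (y : bits) : R :=
  if answer (foldl (@process R n A) u.1 (word emb (-1) (bc u.2 y))) <= midpoint
  then 1 else -1.

(** The norm is at most [2 * k * 2 ^ ell], so a correct estimate lies on the right side of
    [midpoint] once the correlation exceeds [4 * eps * k]; smaller correlations cost at most
    [8 * eps * k]. *)
Lemma decision_correct w b y :
  2 * `|corr J b y| * (success w b y)%:R - `|corr J b y| - 8 * eps * k%:R
  <= decision (message w b) y * corr J b y.
Proof.
set Z := corr J b y.
have dZ : - `|Z| <= decision (message w b) y * Z.
  rewrite /decision; case: ifP => _; rewrite ?mul1r ?mulN1r ?lerN2 ?ler_norm//.
  by rewrite lerNl -normrN ler_norm.
have ek0 : 0 <= eps * k%:R by rewrite mulr_ge0.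
have [/asboolP su|_] := boolP (success w b y); last by rewrite mulr0; lra.
rewrite mulr1.
have [small|big] := leP `|Z| (4 * eps * k%:R); first by lra.
suff : decision (message w b) y * Z = `|Z| by lra.
move: su; rewrite /approximates L0norm_protocol -/Z /output /protocol_stream foldl_cat.
set out := answer _ => -[lo hi].
have p0 : 1 <= (2 ^ ell)%:R :> R by rewrite ler1n expn_gt0.
have JK : #|J|%:R <= k%:R :> R.
  have := sum_level w b b; rewrite [X in (_ = _ + X)%N]big1; last by move=> q _; rewrite eqxx.
  by rewrite ler_nat; lia.
have ZJ : `|Z| <= #|J|%:R.
  apply: le_trans (ler_norm_sum _ _ _) _; rewrite -sum1_card natr_sum; apply: ler_sum => q _.
  by rewrite normrM !norm_sg mulr1.
set P := (2 ^ ell)%:R in lo hi p0 *.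
pose L0 := midpoint - P * Z / 2.
have L0le : L0 <= P * (2 * k%:R).
  have := k_gt0; rewrite -(ltr_nat R) => k0.
  have : 0 <= P * (#|J|%:R + Z) by rewrite mulr_ge0; move: ZJ; rewrite ?ler_norml; lra.
  rewrite /L0 /midpoint -/P; lra.
have eL : eps * L0 <= P * (2 * (eps * k%:R)).
  have := ler_wpM2l eps_ge0 L0le; lra.
rewrite -/L0 in lo hi.
have [Z0|Z0] := leP 0 Z.
  rewrite (ger0_norm Z0) in big *.
  have : P * (4 * eps * k%:R) < P * Z by rewrite ltr_pM2l//; lra.
  rewrite /decision /message /= -/out => ?; rewrite ifT ?mul1r//.
  by move: L0le; rewrite /L0 in lo hi eL *; lra.
rewrite (ltr0_norm Z0) in big *.
have : P * (4 * eps * k%:R) < P * (- Z) by rewrite ltr_pM2l//; lra.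
rewrite /decision /message /= -/out => ?; rewrite ifF ?mulN1r//.
apply/negbTE; rewrite -ltNge.
by rewrite /L0 in lo hi eL *; lra.
Qed.

(** Correlation-weighted success 3/5 leaves an advantage 6/5 - 1 = 1/5; precision costs at most 1/10
    of the mean correlation, and [avg_norm_corr] makes the rest at least sqrt |J| / 40, whose square
    appears. *)
Lemma protocol_bias :
  3 / 5 * avg (fun b : bits => avg (fun y : bits => `|corr J b y| : R)) <=
  avg (fun w => avg (fun b : bits => avg (fun y : bits => `|corr J b y| * (success w b y)%:R))) ->
  exists phi : I -> memory A * D -> R,
    [/\ forall j u, `|phi j u| <= 1,
        forall j, avg (fun w => avg (fun b : bits => sg (b j) * phi j (message w b))) =
                  avg (fun w => avg (fun b : bits => phi j (message w b) ^+ 2)) &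
        #|J|%:R / 1600 <= \sum_(j in J) avg (fun w => avg (fun b : bits => phi j (message w b) ^+ 2))].
Proof.
move=> hs.
have J0 : 0 < #|J|%:R :> R by rewrite ltr0n; have := k_gt0; lia.
pose sJ : R := Num.sqrt #|J|%:R.
have sJ0 : 0 < sJ by rewrite sqrtr_gt0.
have sJ2 : sJ ^+ 2 = #|J|%:R by rewrite sqr_sqrtr// ltW.
have zE := @avg_norm_corr R _ J.
set EZ := avg (fun b : bits => avg (fun y : bits => `|corr J b y|)) in hs zE.
have ek : 80 * (eps * k%:R) <= EZ.
  apply: le_trans zE; rewrite -/sJ.
  suff : 320 * (eps * k%:R) <= sJ by lra.
  rewrite -(@ler_pXn2r _ 2) ?nnegrE ?mulr_ge0 ?(ltW sJ0)// sJ2.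
  have : k%:R <= 2 * #|J|%:R :> R by rewrite -natrM ler_nat.
  have := ler_wpM2r (ler0n R k) epsk.
  have -> : (500 * eps) ^+ 2 * k%:R * k%:R = (500 * (eps * k%:R)) ^+ 2.
    by rewrite -mulrA -[k%:R * k%:R]expr2 -exprMn mulrA.
  have -> : 320 * (eps * k%:R) = 16 / 25 * (500 * (eps * k%:R)) by field.
  set z := 500 * (eps * k%:R).
  have -> : (16 / 25 * z) ^+ 2 = 256 / 625 * z ^+ 2 by field.
  lra.
have main : sJ / 40 <= avg (fun w => avg (fun b => avg (fun y =>
    decision (message w b) y * corr J b y))).
  apply: (@le_trans _ _ (avg (fun w => avg (fun b => avg (fun y =>
     2 * (`|corr J b y| * (success w b y)%:R) - `|corr J b y| - 8 * eps * k%:R))))); last first.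
    apply: ler_avg => w; apply: ler_avg => b; apply: ler_avg => y.
    by rewrite mulrA; exact: decision_correct.
  under avg_eq => w do under avg_eq => b do rewrite avgB avgB (avg_cst ([ffun=> true] : bits)) avgMl.
  under avg_eq => w do rewrite avgB avgB (avg_cst ([ffun=> true] : bits)) avgMl.
  rewrite avgB avgB !(avg_cst w0) avgMl -/EZ.
  move: zE; rewrite -/sJ; lra.
have dec1 u y : `|decision u y| <= 1.
  by rewrite /decision; case: ifP => _; rewrite ?normrN normr1.
have sJ40 : 0 < sJ / 40 by rewrite divr_gt0.
have [phi [h1 h2 h3]] := correlation_bias w0 dec1 sJ40 main.
exists phi; split=> //.
by apply: le_trans h3; rewrite expr_div_n sJ2; lra.
Qed.

End Protocol.

(** The easy direction of Yao's principle: exchange the average over inputs with the integral over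
    seeds. *)
Lemma hard_distribution (R : realType) (d : measure_display) (Seed : measurableType d)
    (P : probability Seed R) (n : nat) (A : Seed -> det_algorithm R n) (eps : R) (W : nat)
    (Idx : finType) (mu : Idx -> R) (st : Idx -> stream n) :
  (forall i, 0 <= mu i) -> \sum_i mu i = 1 ->
  (forall i, unit_update_stream (st i) /\ (size (st i) <= W)%N) ->
  approximates_L0 P A eps W ->
  exists w, 2 / 3 <= \sum_i mu i *
    (`[< approximates eps (frequency_vector (st i)) (output (A w) (st i)) >])%:R.
Proof.
move=> mu0 mu1 stW HA.
apply/not_existsP => nw.
pose E i := success_event A eps (st i).
pose g w : R := \sum_i mu i * (`[< E i w >])%:R.
have glt w : g w < 2 / 3 by rewrite ltNge; apply/negP/nw.
                                                                                        
(* The success weight [g] takes finitely many values, so its values below 2/3 stay below a constant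
   [c < 2/3]; this keeps the inequality strict after integration. *)
pose val (B : {set Idx}) : R := \sum_(i in B) mu i.
pose c : R := \big[Order.max/0]_(B : {set Idx} | val B < 2 / 3) val B.
have c23 : c < 2 / 3.
  by apply: bigmax_lt => //; lra.
have gc w : g w <= c.
  pose B := [set i | `[< E i w >]]%SET.
  have gB : g w = val B.
    rewrite /g /val [RHS]big_mkcond /=; apply: eq_bigr => i _.
    by rewrite inE; case: `[< _ >]; rewrite ?mulr1 ?mulr0.
  by rewrite gB /c; apply: le_bigmax_cond; rewrite -gB.
have mE i : measurable (E i) by have [u s] := stW i; have [] := HA (st i) u s.
have PE i : ((2 / 3 : R)%:E <= P (E i))%E by have [u s] := stW i; have [] := HA (st i) u s.
have mf i : measurable_fun setT ((fun x => (mu i)%:E * (\1_(E i) x)%:E)%E : Seed -> \bar R).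
  apply: measurable_funeM; apply/measurable_EFinP; exact: measurable_indic.
have gE x : (g x)%:E = (\sum_(i <- index_enum Idx) (mu i)%:E * (\1_(E i) x)%:E)%E.
  rewrite /g -sumEFin; apply: eq_bigr => i _; rewrite indicE EFinM.
  suff -> : (x \in E i) = `[< E i x >] by [].
  by apply/idP/asboolP => [/set_mem|/mem_set].
have intg : (\int[P]_x (g x)%:E = \sum_i (mu i)%:E * P (E i))%E.
  under eq_integral do rewrite gE.
  rewrite ge0_integral_sum//; last by move=> i x _; rewrite mule_ge0// lee_fin ?mu0// ?indic_ge0.
  apply: eq_bigr => i _; rewrite ge0_integralZl_EFin ?integral_indic ?setIT//.
  - by apply/measurable_EFinP; exact: measurable_indic.
have low : ((2 / 3 : R)%:E <= \int[P]_x (g x)%:E)%E.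
  rewrite intg.
  have -> : (2 / 3 : R)%:E = (\sum_i (mu i)%:E * (2 / 3 : R)%:E)%E.
    under eq_bigr do rewrite -EFinM.
    by rewrite sumEFin -mulr_suml mu1 mul1r.
  by apply: lee_sum => i _; apply: lee_wpmul2l => //; rewrite lee_fin.
have up : (\int[P]_x (g x)%:E <= c%:E)%E.
  have -> : c%:E = (\int[P]_x (cst c%:E) x)%E.
    rewrite integral_cst// [X in (_ * X)%E](_ : _ = 1%E) ?mule1//.
    exact: probability_setT.
  apply: ge0_le_integral => //.
  - by move=> x _; rewrite lee_fin sumr_ge0// => i _; rewrite mulr_ge0.
  - apply: (eq_measurable_fun (fun x => \sum_(i <- index_enum Idx) (mu i)%:E * (\1_(E i) x)%:E)%E).
      by move=> x _; rewrite gE.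
    exact: emeasurable_sum.
  - by move=> x _; rewrite lee_fin gc.
by have := le_trans low up; rewrite lee_fin leNgt c23.
Qed.

                      

(** * One seed for a family of protocols *)

Section ProtocolFamily.
Context {R : realType} {n L k : nat}.
Local Notation I := ('I_L * 'I_k)%type.
Local Notation bits := {ffun I -> bool}.
Variable emb : {q : I & 'I_(2 ^ q.1)} -> 'I_n.
Hypothesis emb_inj : injective emb.
Context {d : measure_display} {Seed : measurableType d} (P : probability Seed R).
Variables (A : Seed -> det_algorithm R n) (eps : R) (W : nat).
Hypothesis HA : approximates_L0 P A eps W.
Context {Th : finType} (th0 : Th) (ell : Th -> 'I_L) (J : Th -> {set I}).
Hypotheses (J_level : forall th q, q \in J th -> q.1 = ell th).
Hypotheses (kJ : forall th, (k <= 2 * #|J th|)%N).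
Hypotheses (k_gt0 : (0 < k)%N) (eps_ge0 : 0 <= eps) (epsk : (500 * eps) ^+ 2 * k%:R <= 1).
Context {Om : Th -> finType} {D : eqType} (w0 : forall th, Om th).
Variables (al : forall th, Om th -> bits -> stream n) (tot : forall th, Om th -> bits -> I -> nat).
Variables (dat : forall th, Om th -> bits -> D) (bc : Th -> D -> bits -> I -> nat).
Hypothesis al_tot : forall th w b,
  frequency_vector (@al th w b) = frequency_vector (word emb 1 (@tot th w b)).
Hypothesis tot_high : forall th w b y (q : I), (ell th < q.1)%N ->
  @tot th w b q = bc th (@dat th w b) y q.
Hypothesis tot_low : forall th w b y (q : I), (q.1 <= ell th)%N -> q \notin J th ->
  @tot th w b q != bc th (@dat th w b) y q.
Hypothesis tot_J : forall th w b y (q : I), q \in J th ->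
  (@tot th w b q == bc th (@dat th w b) y q) = (b q == y q).

Local Notation st th := (protocol_stream emb (@al th) (@dat th) (bc th)).

Hypothesis st_ok : forall th w b y,
  unit_update_stream (st th w b y) /\ (size (st th w b y) <= W)%N.

(** The seed is fixed before the bound [B], because [B] may depend on the resulting deterministic
    algorithm. A bound that is small on average must be violated by some protocol. *)
Lemma protocol_family : exists w : Seed, forall B : Th -> R,
  (forall th, 0 <= B th) -> avg B <= 1 / 1000 / 15 ->
  exists th, exists phi : I -> memory (A w) * D -> R,
    [/\ forall j u, `|phi j u| <= 1,
        forall j, avg (fun o => avg (fun b : bits =>
                    sg (b j) * phi j (message (A w) (@al th) (@dat th) o b))) =
                  avg (fun o => avg (fun b : bits =>
                    phi j (message (A w) (@al th) (@dat th) o b) ^+ 2)) &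
        #|J th|%:R * B th < \sum_(j in J th) avg (fun o => avg (fun b : bits =>
                    phi j (message (A w) (@al th) (@dat th) o b) ^+ 2))].
Proof.
pose EZ th : R := avg (fun b : bits => avg (fun y : bits => `|corr (J th) b y|)).
have Jp th : 0 < #|J th|%:R :> R by rewrite ltr0n; have := kJ th; have := k_gt0; lia.
have EZ0 th : 0 < EZ th.
  by apply: lt_le_trans (avg_norm_corr (J th)); rewrite divr_gt0// sqrtr_gt0.
pose Cf th : finType := (Om th * (bits * bits))%type.
(* Inputs are weighted by their absolute correlation, normalised within each protocol: success 2/3
   under [mu] is then the weighted success that [protocol_bias] needs. *)
pose mu (i : {th : Th & Cf th}) : R :=
  `|corr (J (tag i)) (tagged i).2.1 (tagged i).2.2| / EZ (tag i)
    / #|Cf (tag i)|%:R / #|Th|%:R.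
pose sti (i : {th : Th & Cf th}) := st (tag i) (tagged i).1 (tagged i).2.1 (tagged i).2.2.
have avg3 th (F : Om th -> bits -> bits -> R) :
    avg (fun c : Cf th => F c.1 c.2.1 c.2.2) = avg (fun o => avg (fun b => avg (fun y => F o b y))).
  rewrite (avg_pair (fun o (c : bits * bits) => F o c.1 c.2)); apply: avg_eq => o.
  by rewrite (avg_pair (fun b y => F o b y)).
have sumE (G : forall th, Om th -> bits -> bits -> R) :
   \sum_i mu i * G (tag i) (tagged i).1 (tagged i).2.1 (tagged i).2.2 =
   avg (fun th => avg (fun o => avg (fun b => avg (fun y => `|corr (J th) b y| * G th o b y))) / EZ th).
  transitivity (\sum_(th : Th) \sum_(c : Cf th)
     (`|corr (J th) c.2.1 c.2.2| / EZ th / #|Cf th|%:R / #|Th|%:R) * G th c.1 c.2.1 c.2.2).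
    by rewrite sig_big_dep /=; apply: eq_bigr => -[th c].
  rewrite [RHS]/avg mulr_suml; apply: eq_bigr => th _.
  rewrite -(avg3 th (fun o b y => `|corr (J th) b y| * G th o b y)) {1}/avg.
  rewrite !mulr_suml; apply: eq_bigr => c _; ring.
have mu_ge0 i : 0 <= mu i.
  by have e := ltW (EZ0 (tag i)); rewrite /mu; do 3 (apply: divr_ge0 => //).
have mu_sum : \sum_i mu i = 1.
  transitivity (\sum_i mu i * 1); first by apply: eq_bigr => i _; rewrite mulr1.
  rewrite (sumE (fun _ _ _ _ => 1)) -[RHS](avg_cst th0); apply: avg_eq => th.
  under avg_eq => o do under avg_eq => b do under avg_eq => y do rewrite mulr1.
  by rewrite (avg_cst (w0 th)) -/(EZ th) divff// gt_eqF.
have [w hw] := hard_distribution mu_ge0 mu_sum (st := sti) (fun i => st_ok _ _ _) HA.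
exists w => B B0 hB.
move: hw; rewrite (sumE (fun th o b y => (`[< approximates eps (frequency_vector (st th o b y))
   (output (A w) (st th o b y)) >])%:R)) => hw.
set s := (fun th : Th => _ / EZ th) in hw.
(* 2/3 - 1000/15000 = 3/5. Since [s th <= 1], this also gives [B th <= 1/2500], below the bias
   1/1600. *)
have [th hth] : exists th, 3 / 5 <= s th - 1000 * B th.
  by apply: (avg_exists th0); rewrite avgB avgMl; lra.
have s1 : s th <= 1.
  rewrite /s ler_pdivrMr// mul1r; apply: (avg_le_cst (w0 th)) => o.
  apply: ler_avg => b; apply: ler_avg => y; rewrite ler_piMr//.
  by case: asboolP; rewrite ?lexx ?ler01.
have B1 : B th <= 1 / 2500 by have := B0 th; lra.
have hs : 3 / 5 * EZ th <= avg (fun o => avg (fun b => avg (fun y =>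
    `|corr (J th) b y| * (success emb (A w) eps (@al th) (@dat th) (bc th) o b y)%:R))).
  rewrite -ler_pdivlMr//; have := B0 th; rewrite -/(s th); lra.
have [phi [h1 h2 h3]] := protocol_bias emb_inj (@J_level th) (kJ th) k_gt0 eps_ge0 epsk
  (w0 th) (@al_tot th) (@tot_high th) (@tot_low th) (@tot_J th) hs.
exists th, phi; split=> //; apply: lt_le_trans h3.
by rewrite ltr_pM2l//; lra.
Qed.

End ProtocolFamily.

(** * The chain rule along levels and a permutation *)

Section Chain.
Context {L k : nat}.
Local Notation I := ('I_L * 'I_k)%type.

(** All levels above [a], and the first [p] blocks of level [a] in the order [s]; the levels are
    thus uncovered from the top, as Bob knows them. *)
Definition chain (s : 'S_k) (a p : nat) : {set I} :=
  [set x : I | (a < x.1)%N || ((x.1 == a :> nat) && ((s^-1)%g x.2 < p)%N)].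

Lemma chainS (s : 'S_k) (a : 'I_L) (p : 'I_k) : chain s a p.+1 = (a, s p) |: chain s a p.
Proof.
apply/setP => -[l q]; rewrite !inE /= xpair_eqE.
have -> : (q == s p) = ((s^-1)%g q == p) by rewrite -(inj_eq (@perm_inj _ s)) permKV.
by rewrite ltnS [((s^-1)%g q <= p)%N]leq_eqVlt -!val_eqE /= andb_orr orbCA.
Qed.

Lemma notin_chain (s : 'S_k) (a : 'I_L) (p : 'I_k) : (a, s p) \notin chain s a p.
Proof. by rewrite inE /= ltnn eqxx permK ltnn. Qed.

Lemma chain_full s (a : nat) : chain s a k = [set x : I | (a <= x.1)%N]%SET.
Proof.
by apply/setP => x; rewrite !inE ltn_ord andbT orbC eq_sym -leq_eqVlt.
Qed.

Lemma chain_empty s (a : nat) : chain s a 0 = [set x : I | (a.+1 <= x.1)%N]%SET.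
Proof. by apply/setP => x; rewrite !inE ltn0 andbF orbF. Qed.

Lemma chain_sum (R : realType) (h : {set I} -> R) (s : 'S_k) : (forall X, 0 <= h X) ->
  \sum_(a < L) \sum_(p < k) (h (chain s a p) - h (chain s a p.+1)) <= h finset.set0.
Proof.
move=> h0.
pose u a := h [set x : I | (a <= x.1)%N]%SET.
have inner (a : 'I_L) : \sum_(p < k) (h (chain s a p) - h (chain s a p.+1)) = u a.+1 - u a.
  rewrite -(big_mkord xpredT (fun p => h (chain s a p) - h (chain s a p.+1))).
  rewrite (@telescope_sumr_eq _ 0 k (fun p => - h (chain s a p))) //; last first.
    by move=> p _; rewrite opprK addrC.
  by rewrite chain_full chain_empty opprK addrC.
under eq_bigr => a _ do rewrite inner.
rewrite -(big_mkord xpredT (fun a => u a.+1 - u a)) telescope_sumr//.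
have -> : u L = h finset.set0.
  by rewrite /u; congr h; apply/setP => x; rewrite !inE leqNgt ltn_ord.
by rewrite lerBlDr lerDl h0.
Qed.

End Chain.

(** * Bias is bounded by information *)

Section BitInformation.
Context {R : realType} {I Q : finType} {D : eqType}.
Local Notation bits := {ffun I -> bool}.

Lemma ln_ge_quadratic (x : R) : -1 / 2 <= x -> x - 2 * x ^+ 2 <= ln (1 + x).
Proof.
move=> hx; have x1 : 0 < 1 + x by lra.
have := ln_le_subr1 (x := (1 + x)^-1); rewrite invr_gt0 lnV ?posrE// => /(_ x1) h.
suff : x - 2 * x ^+ 2 <= 1 - (1 + x)^-1 by lra.
have -> : 1 - (1 + x)^-1 = x / (1 + x) by field; rewrite gt_eqF.
rewrite ler_pdivlMr//.
have : 0 <= x ^+ 2 * (1 + 2 * x) by rewrite mulr_ge0 ?sqr_ge0//; lra.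
have -> : x ^+ 2 * (1 + 2 * x) = x - (x - 2 * x ^+ 2) * (1 + x) by ring.
by lra.
Qed.

(** A Pinsker-type bound. The side information [dt] depends only on coordinates in [X], so the test
    function is admissible in [centropy_gain]. *)
Lemma bit_information (V : bits -> Q) (dt : bits -> D) (X : {set I}) (j : I)
    (phi : Q * D -> R) :
  j \notin X -> (forall f g, dt (merge X f g) = dt f) ->
  (forall u, `|phi u| <= 1) ->
  avg (fun b : bits => sg (b j) * phi (V b, dt b)) = avg (fun b : bits => phi (V b, dt b) ^+ 2) ->
  avg (fun b : bits => phi (V b, dt b) ^+ 2) <= 8 * (centropy V X - centropy V (j |: X)).
Proof.
move=> jX dtX phi1 e.
have dtj f g : dt (merge (j |: X) f g) = dt f.
  by rewrite -(dtX _ f) merge_sub ?finset.subsetUr// dtX.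
(* [G] averages to 1 under redrawing by oddness in [f j]; the factor 1/4 keeps the logarithm in its
   quadratic range and leaves 1/4 - 1/8 = 1/8. *)
pose G (f : bits) v : R := 1 + sg (f j) * phi (v, dt f) / 4.
have x4 (f : bits) v : `|sg (f j) * phi (v, dt f)| <= 1 by rewrite normrM norm_sg mul1r.
have G0 f v : 0 < G f v by have := x4 f v; rewrite /G ler_norml; lra.
have GX f g v : G (merge (j |: X) f g) v = G f v.
  by rewrite /G dtj ffunE !inE eqxx.
have := centropy_gain V [ffun=> true] G0 GX.
have -> : avg (fun f : bits => avg (fun g => G f (V (merge X f g)))) = 1.
  rewrite avg_swap; under avg_eq => g.
    rewrite avgD (avg_cst ([ffun=> true] : bits)) (@avg_odd R I j); first over.
    move=> f; have uj : merge X (upd f j (~~ f j)) g = merge X f g.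
      apply/ffunP => q; rewrite !ffunE; case: ifP => // qX; rewrite ifN//.
      by apply: contraNneq jX => <-.
    have dj : dt (upd f j (~~ f j)) = dt f by rewrite -(dtX _ g) uj dtX.
    by rewrite uj dj ffunE eqxx sg_neg; ring.
  by rewrite addr0 (avg_cst ([ffun=> true] : bits)).
have : avg (fun f : bits => sg (f j) * phi (V f, dt f) / 4 - (phi (V f, dt f) ^+ 2) / 8) <=
    avg (fun f : bits => ln (G f (V f))).
  apply: ler_avg => f; have := x4 f (V f); rewrite /G ler_norml => x4f.
  apply: le_trans (ln_ge_quadratic _); last by lra.
  have -> : (sg (f j) * phi (V f, dt f) / 4) ^+ 2 =
      sg (f j) * sg (f j) * (phi (V f, dt f) ^+ 2 / 16) by field.
  by rewrite sgK mul1r; lra.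
rewrite avgB !avgMr e; lra.
Qed.

End BitInformation.

(** * Stream lengths *)

Section LengthBounds.
Context {n L k : nat}.
Local Notation I := ('I_L * 'I_k)%type.
Variable emb : {q : I & 'I_(2 ^ q.1)} -> 'I_n.
Hypothesis emb_inj : injective emb.

Lemma weight_le (c : I -> nat) (m : nat) : (forall q, c q <= m)%N -> (weight c <= m * n)%N.
Proof.
move=> cm; apply: (@leq_trans (\sum_(q : I) m * 2 ^ q.1)%N).
  by apply: leq_sum => q _; rewrite leq_mul2r cm orbT.
rewrite -big_distrr /= leq_mul2l; apply/orP; right.
have := leq_card emb emb_inj; rewrite card_ord; apply: leq_trans.
rewrite -sum1_card; apply: eq_leq.
transitivity (\sum_(q : I) \sum_(t < 2 ^ q.1) 1)%N.
  by apply: eq_bigr => q _; rewrite sum1_card card_ord.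
by rewrite sig_big_dep.
Qed.

Lemma unit_cat (s1 s2 : stream n) :
  unit_update_stream s1 -> unit_update_stream s2 -> unit_update_stream (s1 ++ s2).
Proof. by rewrite /unit_update_stream all_cat => -> ->. Qed.

End LengthBounds.

                                                                                        
(** * The bound from short streams *)

Section ShortStreams.
Context {R : realType} {n L k : nat}.
Local Notation I := ('I_L * 'I_k)%type.
Local Notation bits := {ffun I -> bool}.
Variable emb : {q : I & 'I_(2 ^ q.1)} -> 'I_n.
Hypothesis emb_inj : injective emb.
Context {d : measure_display} {Seed : measurableType d} (P : probability Seed R).
Variables (A : Seed -> det_algorithm R n) (eps : R) (W S : nat).
Hypotheses (HA : approximates_L0 P A eps W) (HS : uses_space A S).
Hypotheses (L_gt0 : (0 < L)%N) (k_gt0 : (0 < k)%N).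
Hypotheses (eps_ge0 : 0 <= eps) (epsk : (500 * eps) ^+ 2 * k%:R <= 1).
Hypothesis nW : (4 * n <= W)%N.

Let tot1 (l : 'I_L) (_ : unit) (b : bits) (q : I) : nat := (1 + b q)%N.
Let al1 (l : 'I_L) (o : unit) (b : bits) : stream n := word emb 1 (tot1 l o b).
Let dat1 (l : 'I_L) (_ : unit) (b : bits) : bits := [ffun q : I => (l < q.1)%N && b q].
Let bc1 (l : 'I_L) (g y : bits) (q : I) : nat :=
  if (l < q.1)%N then (1 + g q)%N else if q.1 == l then (1 + y q)%N else 0%N.
Let J1 (l : 'I_L) : {set I} := [set q : I | q.1 == l]%SET.

(** Augmented indexing over the levels: the information about level [l] given the levels above sums
    to at most S ln 2 over all levels, but the bias on a violating level requires a constant amount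
    per block. *)
Lemma short_stream_bound : (L * k)%:R / 1000 / 120 < (S%:R : R).
Proof.
rewrite ltNge; apply/negP => Ssmall.
have := @protocol_family R n L k emb emb_inj d Seed P A eps W HA _ (Ordinal L_gt0) id J1
  _ _ k_gt0 eps_ge0 epsk (fun=> unit) bits (fun=> tt) al1 tot1 dat1 bc1.
case.
- by move=> l q; rewrite inE => /eqP.
- by move=> l; rewrite level_set_card; lia.
- by [].
- by move=> l o b y q lq; rewrite /tot1 /bc1 lq ffunE lq.
- move=> l o b y q ql; rewrite inE => ne.
  by rewrite /tot1 /bc1 ltnNge ql /= (negbTE ne).
- move=> l o b y q; rewrite inE => /eqP e.
  by rewrite /tot1 /bc1 e ltnn eqxx; case: (b q); case: (y q).
- move=> l o b y; split; first by apply: unit_cat; apply: unit_word.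
  rewrite /protocol_stream size_cat !size_word; apply: leq_trans nW.
  have -> : (4 * n = 2 * n + 2 * n)%N by lia.
  apply: leq_add; apply: (weight_le emb_inj) => q; rewrite ?/tot1 ?/bc1; first by case: (b q).
  by case: ifP => _; [case: (dat1 _ _ _ _)|case: ifP => // _; case: (y q)].
move=> w hw.
pose V (b : bits) : memory (A w) :=
  foldl (@process R n (A w)) (@initial R n (A w)) (word emb 1 (fun q => 1 + b q)%N).
pose gain (l : 'I_L) (p : 'I_k) : R :=
  centropy V (chain 1%g l p) - centropy V (chain 1%g l p.+1).
have gainE (l : 'I_L) (p : 'I_k) : gain l p = centropy V (chain 1%g l p) - centropy V ((l, p) |: chain 1%g l p).
  by rewrite /gain chainS perm1.
have gain0 l p : 0 <= gain l p.
  by rewrite gainE subr_ge0 (centropy_anti V [ffun=> true]).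
have gsum : \sum_(l < L) \sum_(p < k) gain l p <= S%:R.
  apply: le_trans (@chain_sum L k R (centropy V) 1%g _) _; first exact: centropy_ge0.
  apply: le_trans (centropy_le V _ (HS w) _) _; first by rewrite expn_gt0.
  rewrite natrX lnXn// -[leLHS]mulr_natr -[leRHS]mul1r ler_wpM2r//.
  by have := @ln_le_subr1 R 2 (ltr0Sn _ _); lra.
have k0 : 0 < k%:R :> R by rewrite ltr0n.
have L0 : 0 < L%:R :> R by rewrite ltr0n.
(* The factor 8 is that of [bit_information]; if the claim failed, the average of [B] would be at
   most 8/120000 = 1/15000. *)
pose B (l : 'I_L) : R := 8 / k%:R * \sum_(p < k) gain l p.
have [||l [phi [h1 h2 h3]]] := hw B.
- by move=> l; rewrite mulr_ge0 ?divr_ge0 ?sumr_ge0.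
- rewrite /B avgMl /avg card_ord.
  rewrite (_ : _ * _ = 8 * (\sum_(l < L) \sum_(p < k) gain l p) / (L%:R * k%:R)); last first.
    by field; rewrite !gt_eqF.
  rewrite ler_pdivrMr ?mulr_gt0//.
  by move: Ssmall; rewrite natrM; lra.
move: h3; rewrite ltNge => /negP; apply.
rewrite level_set_card /B mulrA mulrCA mulfV ?gt_eqF// mulr1 mulr_sumr.
have -> : \sum_(j in J1 l) avg (fun o : unit => avg (fun b : bits =>
     phi j (message (A w) (al1 l) (dat1 l) o b) ^+ 2)) =
   \sum_(p < k) avg (fun b : bits => phi (l, p) (V b, dat1 l tt b) ^+ 2).
  rewrite /J1 level_setE.
  rewrite big_imset /=; last by move=> p p' _ _ [].
  by apply: eq_big => [p|p _]; rewrite ?inE// avg_unit.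
apply: ler_sum => p _; rewrite gainE.
apply: bit_information => //.
- by have := notin_chain 1%g l p; rewrite perm1.
- move=> f g; apply/ffunP => q; rewrite !ffunE.
  by case: (ltnP l q.1) => //= lq; rewrite inE lq.
- by have := h2 (l, p); rewrite !avg_unit.
Qed.

End ShortStreams.

                     

(** * Streams made of rounds, with bits only in the side information *)

Section RoundStreams.
Context {R : realType} {n L k : nat}.
Local Notation I := ('I_L * 'I_k)%type.
Local Notation bits := {ffun I -> bool}.
Variable emb : {q : I & 'I_(2 ^ q.1)} -> 'I_n.
Variables (base Lm T' : nat).
Local Notation Om := (@Omega I Lm T').

Definition round_word (w : Om) : stream n :=
  word emb 1 (fun q => base + w.1 q)%N ++ word emb 1 (fun q => w.2 q : nat).

Fixpoint rounds_word t : rounds Om t -> stream n :=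
  if t is t'.+1 then fun p => round_word p.1 ++ rounds_word p.2 else fun=> [::].

Lemma weightD (c c' : I -> nat) :
  weight (fun q => c q + c' q)%N = (weight c + weight c')%N.
Proof. by rewrite /weight -big_split; apply: eq_bigr => q _; rewrite mulnDl. Qed.

Lemma size_round_word w : size (round_word w) = weight (fun q => base + w.1 q + w.2 q)%N.
Proof. by rewrite /round_word size_cat !size_word -weightD. Qed.

Lemma size_rounds_word t (p : rounds Om t) : size (rounds_word p) = weight (totals base p).
Proof.
elim: t p => [|t IH] p /=; first by rewrite /weight big1// => q _; rewrite mul0n.
by rewrite size_cat size_round_word IH -weightD.
Qed.

Lemma frequency_wordD (c c' : I -> nat) :
  frequency_vector (word emb 1 c) + frequency_vector (word emb 1 c') =
  frequency_vector (word emb 1 (fun q => c q + c' q)%N).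
Proof.
rewrite !frequency_word lift_vecD; apply: eq_bigr => q _; apply: eq_bigr => t _.
by rewrite mulrnDr.
Qed.

Lemma frequency_round_word w : frequency_vector (round_word w) =
  frequency_vector (word emb 1 (fun q => base + w.1 q + w.2 q)%N).
Proof. by rewrite frequency_cat frequency_wordD. Qed.

Lemma frequency_rounds_word t (p : rounds Om t) :
  frequency_vector (rounds_word p) = frequency_vector (word emb 1 (totals base p)).
Proof.
elim: t p => [|t IH] p /=.
  rewrite frequency_nil frequency_word /lift_vec big1// => q _; rewrite big1// => t _.
  by rewrite mulr0n scale0r.
by rewrite frequency_cat frequency_round_word IH frequency_wordD.
Qed.

Lemma unit_round_word w : unit_update_stream (round_word w).
Proof. by apply: unit_cat; apply: unit_word. Qed.

Lemma unit_rounds_word t (p : rounds Om t) : unit_update_stream (rounds_word p).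
Proof. by elim: t p => [|t IH] p //=; apply: unit_cat; [exact: unit_round_word|]. Qed.

Lemma totals_le t (p : rounds Om t) q :
  (totals base p q <= t * (base + (Lm`!).*2 + T'))%N.
Proof.
elim: t p => [|t IH] p //=; rewrite mulSn leq_add// leq_add//; last exact/ltnW/ltn_ord.
by rewrite leq_add2l ltnW.
Qed.

Variable A : det_algorithm R n.
Definition block_step (q : I) (s : memory A) : memory A :=
  foldl (@process R n A) s (block emb 1 q).
Local Notation step := (@round_step I (memory A) block_step base Lm T').

Lemma foldl_round_word s w : foldl (@process R n A) s (round_word w) = step s w.
Proof. by rewrite /round_word foldl_cat !foldl_word. Qed.

Lemma foldl_rounds_word t s (p : rounds Om t) :
  foldl (@process R n A) s (rounds_word p) = run step s p.
Proof. by elim: t s p => [|t IH] s p //=; rewrite foldl_cat foldl_round_word IH. Qed.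

(** The randomness of [r + 1 + t] rounds, with the examined round singled out. *)
Definition staged (r t : nat) : finType := (rounds Om r * Om * rounds Om t)%type.

Definition staged_word r t (o : staged r t) : stream n :=
  rounds_word o.1.1 ++ (round_word o.1.2 ++ rounds_word o.2).

Definition staged_total r t (o : staged r t) (q : I) : nat :=
  (totals base o.1.1 q + ((base + o.1.2.1 q + o.1.2.2 q) + totals base o.2 q))%N.

Lemma frequency_staged r t (o : staged r t) : frequency_vector (staged_word o) =
  frequency_vector (word emb 1 (staged_total o)).
Proof.
rewrite /staged_word (frequency_cat (rounds_word _)) (frequency_cat (round_word _)).
by rewrite frequency_round_word !frequency_rounds_word !frequency_wordD.
Qed.

Lemma size_staged r t (o : staged r t) : size (staged_word o) = weight (staged_total o).
Proof.
rewrite /staged_word (size_cat (rounds_word _)) (size_cat (round_word _)).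
by rewrite size_round_word !size_rounds_word -!weightD.
Qed.

Lemma staged_total_le r t (o : staged r t) q :
  (base <= staged_total o q <= (r + t.+1) * (base + (Lm`!).*2 + T'))%N.
Proof.
rewrite /staged_total; have := totals_le o.1.1 q; have := totals_le o.2 q.
have := ltn_ord (o.1.2.1 q); have := ltn_ord (o.1.2.2 q).
rewrite mulnDl mulSn; lia.
Qed.

Lemma foldl_staged r t (o : staged r t) s : foldl (@process R n A) s (staged_word o) =
  run step (step (run step s o.1.1) o.1.2) o.2.
Proof.
rewrite /staged_word (foldl_cat _ _ (rounds_word _)) (foldl_cat _ _ (round_word _)).
by rewrite foldl_round_word !foldl_rounds_word.
Qed.

                                                                                 
(** The bits enter here only, as shifts of the totals by [Lm!]; Alice's stream is independent of
    [b]. *)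
Definition bob_data r t (J K : {set I}) (o : staged r t) (b : bits) : {ffun I -> nat} :=
  [ffun q => if q \in K then staged_total o q + Lm`! * (b q && (q \in J)) else 0]%N.

Variables (M : nat) (QM : (#|memory A| <= M)%N) (Mbase : (M <= base)%N) (T'_gt0 : (0 < T')%N).

(** Guessing [b j] from the message means detecting a shift of the total of [j]. *)
Lemma staged_bit_hidden r t (j : I) (X J K : {set I}) (phi : memory A * {ffun I -> nat} -> R) :
  j \notin X -> j |: X = K -> j \in J ->
  (forall u, `|phi u| <= 1) ->
  avg (fun o : staged r t => avg (fun b : bits => sg (b j) *
    phi (message A (fun o _ => staged_word o) (bob_data J K) o b))) <=
  Erun step r (shift_bound block_step M base Lm T' j X t) (initial A) / 2.
Proof.
move=> jX jXK jJ phi1; rewrite avg_swap.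
pose F (b : bits) := avg (fun o : staged r t => sg (b j) *
    phi (message A (fun o _ => staged_word o) (bob_data J K) o b)).
rewrite -/(avg F).
(* Pair each [b] with its flip at [j]: the two messages differ only by [Lm!] in one entry of Bob's
   data. *)
have -> : avg F = avg (fun b => (F b + F (upd b j (~~ b j))) / 2).
  by rewrite avgMr avgD -(avg_flip j F); field.
apply: (avg_le_cst [ffun=> true]) => b; rewrite ler_pM2r//.
pose H (c : bool) := avg (fun o : staged r t =>
  phi (message A (fun o _ => staged_word o) (bob_data J K) o (upd b j c))).
have -> : F b + F (upd b j (~~ b j)) = H false - H true.
  have Fu c : F (upd b j c) = sg c * H c.
    by rewrite /F /H -avgMl; apply: avg_eq => o; rewrite ffunE eqxx.
  have bE : upd b j (b j) = b by apply/ffunP => q; rewrite ffunE; case: eqP => // ->.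
  by rewrite -{1}bE !Fu; case: (b j); rewrite /sg /= ?expr0 ?expr1 ?mul1r ?mulN1r// addrC.
pose psi s (g : {ffun I -> nat}) : R :=
  phi (s, [ffun q => if q \in K then g q + Lm`! * (upd b j false q && (q \in J)) else 0]%N).
have := @totals_shift_unnoticed R I (memory A) block_step M base Lm T' QM Mbase T'_gt0 j X jX
  r t (initial A) psi (fun _ _ => phi1 _).
apply: le_trans; rewrite /H -avgB.
rewrite le_eqVlt; apply/orP; left; apply/eqP.
rewrite -(avg_pair (fun pre w => avg (fun post : rounds Om t => _))).
rewrite -(avg_pair (fun (c : rounds Om r * Om) (post : rounds Om t) => _)).
apply: avg_eq => -[[pre w] post] /=.
rewrite /message /psi !foldl_staged /=.
congr (phi (_, _) - phi (_, _)).
- apply/ffunP => q; rewrite !ffunE; case: ifP => // qK.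
  by rewrite jXK qK /staged_total /=.
- apply/ffunP => q; rewrite !ffunE; case: ifP => // qK.
  rewrite jXK qK /staged_total /=; case: eqP => [->|_]; last by rewrite muln0 addn0.
  by rewrite jJ !muln1 muln0 addn0.
Qed.

End RoundStreams.

Lemma shifted_eq (x r : nat) (b y : bool) : (0 < r)%N -> (r <= x)%N ->
  (x == x + r * b - r * y)%N = (b == y).
Proof. by case: b; case: y; rewrite ?muln1 ?muln0 /= => *; lia. Qed.

(** * The bound from long streams *)

Section LongStreams.
Context {R : realType} {n L k' : nat}.
Local Notation k := (k'.*2).
Local Notation I := ('I_L * 'I_k)%type.
Local Notation bits := {ffun I -> bool}.
Variable emb : {q : I & 'I_(2 ^ q.1)} -> 'I_n.
Hypothesis emb_inj : injective emb.
Context {d : measure_display} {Seed : measurableType d} (P : probability Seed R).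
Variables (A : Seed -> det_algorithm R n) (eps : R) (W S Lm : nat).
Hypotheses (HA : approximates_L0 P A eps W) (HS : uses_space A S).
Hypotheses (L_gt0 : (0 < L)%N) (k'_gt0 : (0 < k')%N) (Lm_gt0 : (0 < Lm)%N).
Hypotheses (eps_ge0 : 0 <= eps) (epsk : (500 * eps) ^+ 2 * k%:R <= 1).
Hypothesis lnLm : 8 <= ln Lm%:R :> R.
Variable a : nat.
Hypothesis a_large : 1000 * 1000 <= a%:R :> R.

(** In [base], [M] repetitions reach the cycles and the extra [Lm!] keeps Bob's truncated
    subtraction exact. [T'] and [tau] make boundary terms and forgetting, respectively, O(1/a) on
    average. *)
Local Notation M := (2 ^ S)%N.
Local Notation base := (M + Lm`!)%N.
Local Notation T' := (a * Lm`!)%N.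
Local Notation tau := (a ^ 2 * M ^ 3)%N.
Local Notation len := (tau * (base + (Lm`!).*2 + T'))%N.
Hypothesis nW : ((len + (len + Lm`!)) * n <= W)%N.

Let M_gt0 : (0 < M)%N. Proof. by rewrite expn_gt0. Qed.
Let r_gt0 : (0 < Lm`!)%N. Proof. exact: fact_gt0. Qed.
Let a_gt0 : (0 < a)%N. Proof. by rewrite -(ltr_nat R); move: a_large; lra. Qed.
Let T'_gt0 : (0 < T')%N. Proof. by rewrite muln_gt0 a_gt0 r_gt0. Qed.
Let tau_gt0 : (0 < tau)%N. Proof. by rewrite muln_gt0 !expn_gt0 a_gt0. Qed.
Let k_gt0 : (0 < k)%N. Proof. by rewrite double_gt0. Qed.

(** A protocol is given by an order of the blocks, an examined round, a level and a position.
    Positions lie in the upper half, so that [J] has at least [k / 2] blocks. *)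
Local Notation Th := ('S_k * 'I_tau * ('I_L * 'I_k'))%type.

Let upper_proof (p : 'I_k') : (k' + p < k)%N.
Proof. by rewrite -addnn ltn_add2l. Qed.
Let upper (p : 'I_k') : 'I_k := Ordinal (upper_proof p).

Let sgm (th : Th) : 'S_k := th.1.1.
Let rnd (th : Th) : nat := th.1.2.
Let lev (th : Th) : 'I_L := th.2.1.
Let pos (th : Th) : 'I_k := upper th.2.2.
Let later (r : nat) := (tau.-1 - r)%N.

Let J (th : Th) : {set I} :=
  [set x : I | (x.1 == lev th) && (((sgm th)^-1)%g x.2 <= pos th)%N]%SET.
Let K (th : Th) : {set I} := chain (sgm th) (lev th) (pos th).+1.
Let Om (th : Th) : finType := @staged L k Lm T' (rnd th) (later (rnd th)).
Let w0 : @Omega I Lm T' :=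
  ([ffun=> Ordinal (eq_ind_r _ r_gt0 (double_gt0 Lm`!) : (0 < (Lm`!).*2)%N)], [ffun=> Ordinal T'_gt0]).
Let bc (th : Th) (g : {ffun I -> nat}) (y : bits) (q : I) : nat :=
  if q \in J th then (g q - Lm`! * y q)%N else g q.

Let JE th : J th = ((fun q : 'I_k => (lev th, sgm th q)) @: [set q : 'I_k | (q <= pos th)%N])%SET.
Proof.
apply/setP => -[l q]; rewrite !inE /=; apply/andP/imsetP => [[/eqP-> h]|[q' h [-> ->]]].
  by exists ((sgm th)^-1 q)%g; rewrite ?inE// permKV.
by rewrite eqxx permK; move: h; rewrite inE.
Qed.

Let sumJ th (f : I -> R) :
  \sum_(j in J th) f j = \sum_(q < k | (q <= pos th)%N) f (lev th, sgm th q).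
Proof.
rewrite JE big_imset /=; last by move=> q q' _ _ [/perm_inj].
by apply: eq_bigl => q; rewrite inE.
Qed.

Let cardJ th : #|J th| = (pos th).+1.
Proof.
rewrite JE card_imset; last by move=> q q' [/perm_inj].
rewrite -sum1_card (eq_bigl (fun q : 'I_k => (q < (pos th).+1)%N)); last by move=> q; rewrite inE ltnS.
by rewrite -(big_ord_widen k (fun=> 1%N) (ltn_ord (pos th))) sum1_card card_ord.
Qed.

Let JK th q : q \in J th -> q \in K th.
Proof. by rewrite !inE => /andP[/eqP-> h]; rewrite eqxx ltnS h orbT. Qed.

                                                                                    
                                                                  
(** Every block of [J] must be handled while all other blocks of [K] are disclosed. Swapping it to
    the last position leaves [K] unchanged, so its information gain becomes the chain increment at
    [pos th] for another order. *)
Let swapped (th : Th) (q0 : 'I_k) : 'S_k := (tperm q0 (pos th) * sgm th)%g.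
Let Xq (th : Th) (q0 : 'I_k) : {set I} := chain (swapped th q0) (lev th) (pos th).

Let swappedE th q0 : swapped th q0 (pos th) = sgm th q0.
Proof. by rewrite permM tpermR. Qed.

Let Xq_notin th q0 : (lev th, sgm th q0) \notin Xq th q0.
Proof. by have := notin_chain (swapped th q0) (lev th) (pos th); rewrite swappedE. Qed.

Let XqS th q0 : (lev th, sgm th q0) |: Xq th q0 = chain (swapped th q0) (lev th) (pos th).+1.
Proof. by rewrite chainS swappedE. Qed.

Let XqK th (q0 : 'I_k) : (q0 <= pos th)%N -> (lev th, sgm th q0) |: Xq th q0 = K th.
Proof.
move=> q0p; rewrite XqS; apply/setP => x; rewrite !inE; congr (_ || (_ && _)).
rewrite invMg tpermV permM !ltnS.
by case: tpermP => // ->; rewrite ?leqnn ?q0p.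
Qed.

Section Deterministic.
Variable B0 : det_algorithm R n.
Hypothesis QM : (#|memory B0| <= M)%N.
Local Notation bs := (@block_step R n L k emb B0).
Local Notation step := (@round_step I (memory B0) bs base Lm T').
Local Notation s0 := (initial B0).

Let gain s sig (l : 'I_L) (p : nat) : R :=
  centropy (@mid_of I _ bs base Lm s) (chain sig l p)
  - centropy (@mid_of I _ bs base Lm s) (chain sig l p.+1).

Let gain_ge0 s sig l (p : 'I_k) : 0 <= gain s sig l p.
Proof. by rewrite /gain chainS subr_ge0 (centropy_anti _ w0.1). Qed.

Let sum_gain s sig : \sum_(l < L) \sum_(p < k') gain s sig l (k' + p) <= S%:R.
Proof.
apply: (@le_trans _ _ (\sum_(l < L) \sum_(p < k) gain s sig l p)).
  apply: ler_sum => l _.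
  rewrite -(big_mkord xpredT (fun p => gain s sig l (k' + p))) -sum_nat_shift addnn.
  rewrite -[leRHS](big_mkord xpredT (fun p => gain s sig l p)).
  rewrite [leRHS](@big_cat_nat _ _ _ k') //=; last by rewrite -addnn leq_addr.
  rewrite lerDr big_mkord sumr_ge0// => p _.
  have pk : (p < k)%N by apply: leq_trans (ltn_ord p) _; rewrite -addnn leq_addr.
  exact: (gain_ge0 s sig l (Ordinal pk)).
apply: le_trans (@chain_sum L k R (centropy (@mid_of I _ bs base Lm s)) sig _) _.
  exact: centropy_ge0.
apply: le_trans (centropy_le _ _ QM M_gt0) _.
rewrite natrX lnXn// -[leLHS]mulr_natr -[leRHS]mul1r ler_wpM2r//.
by have := @ln_le_subr1 R 2 (ltr0Sn _ _); lra.
Qed.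

Let rv th q0 := @reveal I Lm T' (lev th, sgm th q0) (Xq th q0).
Let gam : R := (a%:R * M%:R ^+ 2)^-1.
Let kap : R := 3 / 4 * ln Lm%:R - 2.
Let c1 : R := (8 * M%:R + 6) / (4 * gam).

(** The constant 15/2 collects 4 from the boundary term [8 * Lm! / T'] and 7/2 from passing to the
    l1 norm, the latter using [gam = 1 / (a * M ^ 2)]. *)
Let pbound th q0 : R :=
  15 / 2 / a%:R
  + c1 * Erun step (rnd th) (forgetting step (rv th q0) (later (rnd th))) s0
  + Erun step (rnd th) (fun s => gain s (swapped th q0) (lev th) (pos th)) s0 / kap.

Let MR : 1 <= M%:R :> R. Proof. by rewrite ler1n. Qed.
Let aR : 0 < a%:R :> R. Proof. by rewrite ltr0n. Qed.
Let gam_gt0 : 0 < gam. Proof. by rewrite invr_gt0 mulr_gt0// exprn_gt0// (lt_le_trans ltr01). Qed.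
Let kap_gt0 : 0 < kap. Proof. by rewrite /kap; move: lnLm; lra. Qed.

Let shift_bound_le th q0 :
  Erun step (rnd th) (shift_bound bs M base Lm T' (lev th, sgm th q0) (Xq th q0) (later (rnd th))) s0 / 2
  <= pbound th q0.
Proof.
have h s : shift_bound bs M base Lm T' (lev th, sgm th q0) (Xq th q0) (later (rnd th)) s / 2 <=
   15 / 2 / a%:R + c1 * forgetting step (rv th q0) (later (rnd th)) s
   + gain s (swapped th q0) (lev th) (pos th) / kap.
  rewrite /shift_bound.
  set f1 := forgetting1 _ _ _ _.
  have hf1 : f1 <= (M%:R * gam + forgetting step (rv th q0) (later (rnd th)) s / gam) / 2.
    exact: (forgetting1_le _ _ w0).
  have hp := @pbad_le R I (memory B0) bs base Lm T' T'_gt0 (lev th, sgm th q0) (Xq th q0)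
    (Xq_notin th q0) (later (rnd th)) s Lm_gt0.
  rewrite XqS -/(gain s (swapped th q0) (lev th) (pos th)) -/kap -ler_pdivlMr// in hp.
  set pb := pbad _ _ _ _ _ _ _ _ in hp *.
  set f := forgetting _ _ _ _ in hf1 *.
  set g := gain _ _ _ _ in hp *.
  have e1 : 8 * (Lm`!)%:R / T'%:R = 8 / a%:R :> R.
    by rewrite natrM; field; rewrite !gt_eqF// ltr0n.
  have e2 : (8 * M%:R + 6) * f1 / 2 <= (8 * M%:R + 6) * (M%:R * gam) / 4 + c1 * f.
    have -> : (8 * M%:R + 6) * (M%:R * gam) / 4 + c1 * f =
      (8 * M%:R + 6) * ((M%:R * gam + f / gam) / 2) / 2.
      by rewrite /c1; field; rewrite gt_eqF.
    by rewrite ler_pM2r// ler_wpM2l//; move: MR; lra.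
  have e3 : (8 * M%:R + 6) * (M%:R * gam) / 4 <= 7 / 2 / a%:R :> R.
    have M0 : 0 < M%:R :> R by move: MR; lra.
    have -> : (8 * M%:R + 6) * (M%:R * gam) / 4 = (8 * M%:R + 6) / (4 * M%:R) / a%:R.
      by rewrite /gam; field; rewrite !gt_eqF.
    rewrite ler_pM2r ?invr_gt0// ler_pdivrMr ?mulr_gt0//; move: MR; lra.
  rewrite e1; lra.
exact: (@Erun_le_affine _ _ step R w0 (rnd th)
  (shift_bound bs M base Lm T' (lev th, sgm th q0) (Xq th q0) (later (rnd th)))
  (forgetting step (rv th q0) (later (rnd th)))
  (fun s => gain s (swapped th q0) (lev th) (pos th)) _ _ _ _ s0 h).
Qed.

Let mean_pos (p : 'I_k) (f : 'I_k -> R) : R :=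
  (\sum_(q < k | (q <= p)%N) f q) / p.+1%:R.

Let ler_mean_pos p f g : (forall q, f q <= g q) -> mean_pos p f <= mean_pos p g.
Proof. by move=> fg; rewrite /mean_pos ler_wpM2r ?invr_ge0// ler_sum. Qed.

Let mean_pos_cst p c : mean_pos p (fun=> c) = c.
Proof.
rewrite /mean_pos -(big_ord_widen k (fun=> c) (ltn_ord p)) sumr_const card_ord.
by rewrite -[c *+ _]mulr_natr mulfK// pnatr_eq0.
Qed.

Let mean_posD p f g : mean_pos p (fun q => f q + g q) = mean_pos p f + mean_pos p g.
Proof. by rewrite /mean_pos big_split mulrDl. Qed.

Let mean_posMr p f c : mean_pos p (fun q => f q * c) = mean_pos p f * c.
Proof. by rewrite /mean_pos -mulr_suml mulrAC. Qed.

Let avg_mean_pos (U : finType) p (f : U -> 'I_k -> R) :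
  avg (fun u => mean_pos p (f u)) = mean_pos p (fun q => avg (f^~ q)).
Proof. by rewrite /mean_pos avgMr avg_sum. Qed.

Let bound th : R := mean_pos (pos th) (pbound th).

(** Averaging over the examined round gives at most [c1 / tau]; [tau] is chosen to make this
    O(1/a). *)
Let avg_forgetting (sig : 'S_k) (l : 'I_L) (p : 'I_k') (q0 : 'I_k) :
  avg (fun r : 'I_tau => c1 * Erun step (rnd (sig, r, (l, p)))
    (forgetting step (rv (sig, r, (l, p)) q0) (later (rnd (sig, r, (l, p))))) s0)
  <= 7 / 2 / a%:R.
Proof.
rewrite avgMl /avg card_ord.
have := @sum_forgetting (memory B0) _ step R _ (rv (sig, Ordinal tau_gt0, (l, p)) q0) w0 tau s0.
rewrite big_mkord => h.
have M0 : 0 < M%:R :> R by move: MR; lra.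
have c10 : 0 < c1 by rewrite /c1 divr_gt0 ?mulr_gt0//; move: MR; lra.
have tauE : tau%:R = a%:R ^+ 2 * M%:R ^+ 3 :> R by rewrite natrM !natrX.
apply: (@le_trans _ _ (c1 * (1 / tau%:R))).
  by rewrite ler_pM2l// ler_wpM2r// invr_ge0.
rewrite tauE; have -> : c1 * (1 / (a%:R ^+ 2 * M%:R ^+ 3)) = (8 * M%:R + 6) / (4 * M%:R) / a%:R.
  by rewrite /c1 /gam; field; rewrite !gt_eqF.
rewrite ler_pM2r ?invr_gt0// ler_pdivrMr ?mulr_gt0//; move: MR; lra.
Qed.

(** Multiplication by a transposition permutes the orders, so the swapped order is again uniform;
    the chain rule then spreads at most S nats over [L * k'] pairs of level and position. *)
Let avg_gain (r : nat) :
  avg (fun lp : 'I_L * 'I_k' => avg (fun sig : 'S_k => mean_pos (upper lp.2) (fun q0 =>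
    Erun step r (fun s => gain s (tperm q0 (upper lp.2) * sig)%g lp.1 (upper lp.2)) s0)))
  <= S%:R / (L%:R * k'%:R).
Proof.
rewrite (@avg_eq _ _ _ (fun lp : 'I_L * 'I_k' => avg (fun sig : 'S_k =>
   Erun step r (fun s => gain s sig lp.1 (upper lp.2)) s0))); last first.
  move=> [l p] /=; rewrite avg_mean_pos -[RHS](mean_pos_cst (upper p)).
  congr (_ / _); apply: eq_bigr => q0 _.
  rewrite [RHS](@avg_reindex _ _ _ (fun sig : 'S_k => (tperm q0 (upper p) * sig)%g))//.
  by exists (fun sig : 'S_k => ((tperm q0 (upper p))^-1 * sig)%g) => sig; rewrite ?mulKg ?mulKVg.
rewrite avg_swap; apply: (avg_le_cst 1%g) => sig.
rewrite avg_swap; apply: (avg_le_cst (rounds_inh w0 r)) => pre.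
set s := run _ _ _.
rewrite (avg_pair (fun l p => gain s sig l (upper p))) /avg !card_ord.
by rewrite -mulr_suml -mulrA -invfM [k'%:R * _]mulrC ler_wpM2r ?invr_ge0 ?mulr_ge0.
Qed.

Let bound_ge0 th : 0 <= bound th.
Proof.
rewrite /bound /mean_pos mulr_ge0 ?invr_ge0// sumr_ge0// => q0 _.
apply: addr_ge0; [apply: addr_ge0|].
- by rewrite !divr_ge0.
- apply: mulr_ge0; first by rewrite /c1 divr_ge0 ?mulr_ge0 ?addr_ge0 ?mulr_ge0// ltW.
  by do 3 (apply: avg_ge0 => ?); rewrite sumr_ge0// => o _; exact: sqr_ge0.
- rewrite divr_ge0 ?(ltW kap_gt0)//; apply: avg_ge0 => p; exact: gain_ge0.
Qed.

Let avg_bound : avg bound <= 11 / a%:R + S%:R / (L%:R * k'%:R) / kap.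
Proof.
pose t1 th := mean_pos (pos th) (fun q0 => c1 * Erun step (rnd th)
  (forgetting step (rv th q0) (later (rnd th))) s0).
pose t2 th := mean_pos (pos th) (fun q0 =>
  Erun step (rnd th) (fun s => gain s (swapped th q0) (lev th) (pos th)) s0).
have bE th : bound th = 15 / 2 / a%:R + t1 th + t2 th / kap.
  by rewrite -[X in X + _ + _](mean_pos_cst (pos th)) -mean_posMr -!mean_posD.
rewrite (avg_eq bE) avgD avgD avgMr.
have th0 : Th := (1%g, Ordinal tau_gt0, (Ordinal L_gt0, Ordinal k'_gt0)).
rewrite (avg_cst th0).
have a1 : avg t1 <= 7 / 2 / a%:R.
  rewrite avg_pairE avg_swap; apply: (avg_le_cst (Ordinal L_gt0, Ordinal k'_gt0)) => -[l p].
  rewrite avg_pairE; apply: (avg_le_cst 1%g) => sig.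
  rewrite /t1 /pos /= avg_mean_pos -[leRHS](mean_pos_cst (upper p)).
  by apply: ler_mean_pos => q0; exact: avg_forgetting.
have a2 : avg t2 <= S%:R / (L%:R * k'%:R).
  rewrite avg_pairE avg_pairE avg_swap; apply: (avg_le_cst (Ordinal tau_gt0)) => r.
  rewrite avg_swap; exact: (avg_gain r).
have := @ler_wpM2r _ kap^-1 _ _ _ a2; rewrite invr_ge0 (ltW kap_gt0) => /(_ isT); lra.
Qed.

Lemma deterministic_bound : exists B : Th -> R,
  [/\ forall th, 0 <= B th,
      avg B <= 11 / a%:R + S%:R / (L%:R * k'%:R) / (3 / 4 * ln Lm%:R - 2) &
      forall th (phi : I -> memory B0 * {ffun I -> nat} -> R),
        (forall j u, `|phi j u| <= 1) ->
        \sum_(j in J th) avg (fun o : Om th => avg (fun b : bits => sg (b j) *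
          phi j (message B0 (fun o _ => staged_word emb base o)
                            (bob_data base (J th) (K th)) o b)))
        <= #|J th|%:R * B th].
Proof.
exists bound; split; [exact: bound_ge0|exact: avg_bound|] => th phi phi1.
rewrite sumJ cardJ /bound /mean_pos mulrCA mulfV ?pnatr_eq0// mulr1.
apply: ler_sum => q0 q0p; apply: le_trans (shift_bound_le th q0).
have jJ : (lev th, sgm th q0) \in J th by rewrite inE /= eqxx permK.
exact: (@staged_bit_hidden R n L k emb base Lm T' B0 M QM (leq_addr _ _) T'_gt0
  (rnd th) (later (rnd th)) (lev th, sgm th q0) (Xq th q0) (J th) (K th) (phi _)
  (Xq_notin th q0) (XqK q0p) jJ (phi1 _)).
Qed.

End Deterministic.

(** If S were small, the average of the bound in [deterministic_bound] would be at most 1/15000, and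
    [protocol_family] would produce a bias exceeding what hidden bits permit. *)
Lemma long_stream_bound : (L * k')%:R * ln Lm%:R / 1000 / 60 < (S%:R : R).
Proof.
rewrite ltNge; apply/negP => Ssmall.
have lno (r : 'I_tau) : (r + (later r).+1)%N = tau by rewrite /later; have := ltn_ord r; lia.
have totle th (o : Om th) q : (base <= staged_total base o q <= len)%N.
  have := @staged_total_le L k base Lm T' (rnd th) (later (rnd th)) o q.
  by rewrite (lno th.1.2).
have := @protocol_family R n L k emb emb_inj d Seed P A eps W HA Th
  (1%g, Ordinal tau_gt0, (Ordinal L_gt0, Ordinal k'_gt0)) lev J
  _ _ k_gt0 eps_ge0 epsk Om {ffun I -> nat}
  (fun th => (rounds_inh w0 (rnd th), w0, rounds_inh w0 (later (rnd th))))
  (fun th o _ => staged_word emb base o) (fun th o _ => staged_total base o)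
  (fun th => bob_data base (J th) (K th)) bc.
case.
- by move=> th q; rewrite inE => /andP[/eqP].
- by move=> th; rewrite cardJ /=; lia.
- by move=> th o b; exact: frequency_staged.
- move=> th o b y q lq; rewrite /bc.
  have qJ : q \notin J th by rewrite inE negb_and -val_eqE /= gtn_eqF.
  by rewrite (negbTE qJ) ffunE (negbTE qJ) andbF muln0 addn0 inE lq.
- move=> th o b y q ql qJ; rewrite /bc (negbTE qJ) ffunE.
  have qK : q \notin K th.
    apply: contra qJ; rewrite !inE ltnNge ql /= ltnS => /andP[/eqP e ->].
    by rewrite -val_eqE /= e eqxx.
  rewrite (negbTE qK) -lt0n; have /andP[h _] := totle th o q.
  by apply: leq_trans h; rewrite addn_gt0 M_gt0.
- move=> th o b y q qJ; rewrite /bc qJ ffunE (JK qJ) qJ andbT.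
  have /andP[h _] := totle th o q; apply: shifted_eq => //.
  by apply: leq_trans h; exact: leq_addl.
- move=> th o b y; split.
    apply: unit_cat; last by apply: unit_word.
    apply: unit_cat; first exact: unit_rounds_word.
    by apply: unit_cat; [exact: unit_round_word|exact: unit_rounds_word].
  rewrite /protocol_stream size_cat size_staged size_word; apply: leq_trans nW.
  rewrite mulnDl; apply: leq_add; apply: (weight_le emb_inj) => q.
    by have /andP[] := totle th o q.
  have /andP[_ h] := totle th o q.
  have g1 : (bob_data base (J th) (K th) o b q <= len + Lm`!)%N.
    rewrite ffunE; case: ifP => // _; apply: leq_add => //.
    by case: (_ && _); rewrite ?muln1 ?muln0.
  by rewrite /bc; case: ifP => // _; apply: leq_trans g1; exact: leq_subr.
move=> w hw.
have QM : (#|memory (A w)| <= M)%N by exact: HS.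
have [B [B0 hB HB]] := deterministic_bound QM.
have [|th [phi [h1 h2 h3]]] := hw B B0.
  apply: le_trans hB _.
  have L0 : 0 < L%:R :> R by rewrite ltr0n.
  have k0 : 0 < k'%:R :> R by rewrite ltr0n.
  have a0 : 0 < a%:R :> R by rewrite ltr0n.
  (* The budget 1/15000 is split evenly; for ln [Lm] >= 8 the denominator 3/4 ln [Lm] - 2 is at
     least ln [Lm] / 2. *)
  have b1 : 11 / a%:R <= 1 / 1000 / 30 :> R.
    by rewrite ler_pdivrMr//; move: a_large; lra.
  suff : S%:R / (L%:R * k'%:R) / (3 / 4 * ln Lm%:R - 2) <= 1 / 1000 / 30 :> R by lra.
  have kp : 0 < 3 / 4 * ln Lm%:R - 2 :> R by move: lnLm; lra.
  rewrite ler_pdivrMr// ler_pdivrMr ?mulr_gt0//.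
  apply: le_trans Ssmall _; rewrite natrM.
  set LK := L%:R * k'%:R; have LK0 : 0 < LK by rewrite mulr_gt0.
  have -> : LK * ln Lm%:R / 1000 / 60 = (ln Lm%:R / 1000 / 60) * LK by ring.
  by rewrite ler_pM2r//; move: lnLm; lra.
move: h3; rewrite ltNge => /negP; apply.
under eq_bigr => j _ do rewrite -h2.
exact: HB.
Qed.

End LongStreams.

                             

(** * Choice of the grid of blocks *)

Lemma block_embedding (n L k : nat) : (k * 2 ^ L <= n)%N ->
  exists emb : {q : 'I_L * 'I_k & 'I_(2 ^ q.1)} -> 'I_n, injective emb.
Proof.
move=> kn.
have cn : (#|{: {q : 'I_L * 'I_k & 'I_(2 ^ q.1)}}| <= n)%N.
  apply: leq_trans kn.
  have -> : #|{: {q : 'I_L * 'I_k & 'I_(2 ^ q.1)}}| = (\sum_(q : 'I_L * 'I_k) 2 ^ q.1)%N.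
    rewrite -sum1_card; transitivity (\sum_(q : 'I_L * 'I_k) \sum_(t < 2 ^ q.1) 1)%N.
      by rewrite sig_big_dep.
    by apply: eq_bigr => q _; rewrite sum1_card card_ord.
  have -> : (\sum_(q : 'I_L * 'I_k) 2 ^ q.1 = \sum_(l < L) \sum_(p < k) 2 ^ l)%N.
    by rewrite pair_big.
  under eq_bigr => l _ do rewrite sum_nat_const card_ord.
  rewrite -big_distrr leq_mul2l /=; apply/orP; right.
  by have := predn_exp 2 L; rewrite mul1n => <-; exact: leq_pred.
exists (fun x => widen_ord cn (enum_rank x)) => x y /(congr1 val) /= /val_inj.
exact: enum_rank_inj.
Qed.

Section GridParameters.
Context {R : realType}.
Implicit Types (x y : R).

Lemma ln_ge_subV x : 0 < x -> 1 - x^-1 <= ln x.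
Proof.
move=> x0; have := @ln_le_subr1 R x^-1; rewrite invr_gt0 lnV ?posrE// => /(_ x0); lra.
Qed.

Lemma ln2_ge : 1 / 2 <= ln 2 :> R.
Proof. by have := @ln_ge_subV 2 (ltr0Sn _ _); lra. Qed.

Lemma ln2_le : ln 2 <= 1 :> R.
Proof. by have := @ln_le_subr1 R 2 (ltr0Sn _ _); lra. Qed.

Lemma ln_le_powR x y (W : R) : 0 < x -> 0 < W -> x `^ y <= W -> y * ln x <= ln W.
Proof. by move=> x0 W0 h; rewrite -ln_powR ler_ln ?posrE ?powR_gt0. Qed.

Lemma fact_le_expR (m : nat) x : m%:R ^+ 2 <= x -> (m`!)%:R <= expR x.
Proof.
move=> mx; apply: (@le_trans _ _ (expR (m%:R ^+ 2))); last by rewrite ler_expR.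
rewrite expr2 expRM_natl.
apply: (@le_trans _ _ (m%:R ^+ m)); last first.
  by rewrite lerXn2r ?nnegrE ?expR_ge0//; have := expR_ge1Dx (m%:R : R); lra.
rewrite -natrX ler_nat.
have fle j : (j <= m)%N -> (j`! <= m ^ j)%N.
  elim: j => [|j IH] jm; first by rewrite fact0 expn0.
  by rewrite factS expnS leq_mul// IH// ltnW.
exact: fle.
Qed.

Variables (n : nat) (eps : R).
Hypotheses (n_gt0 : (0 < n)%N) (eps_low : n%:R `^ (- (49 / 100)) <= eps) (eps_up : eps <= 1 / 1000).

Let n0 : 0 < n%:R :> R. Proof. by rewrite ltr0n. Qed.

Lemma eps_gt0 : 0 < eps.
Proof. exact: lt_le_trans (powR_gt0 _ n0) eps_low. Qed.

Lemma ln_eps : - ln eps <= 49 / 100 * ln n%:R.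
Proof. by have := ln_le_powR n0 eps_gt0 eps_low; lra. Qed.

Lemma ln_n_ge1 : 1 <= ln n%:R :> R.
Proof.
have := ln_le_subr1 eps_gt0; have := eps_up; have := ln_eps; lra.
Qed.

                                                                                
                                  
(** [k'] is the integer part of (500 eps)^-2 / 2, and [2 ^ L] fills the remaining room in [n]. *)
Lemma grid_parameters : exists k' L : nat,
  [/\ (0 < k')%N, (0 < L)%N, (k'.*2 * 2 ^ L <= n)%N,
      (500 * eps) ^+ 2 * (k'.*2)%:R <= 1 &
      eps ^- 2 * ln n%:R <= (1000 * 1000 * 50) * (L * k')%:R].
Proof.
have e0 := eps_gt0.
have [z zE] : exists z, z = 500 * eps by exists (500 * eps).
have z0 : 0 < z by move: e0; lra.
have zh : z <= 1 / 2 by have := eps_up; lra.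
rewrite -zE.
have u0 : 0 < z ^+ 2 by rewrite exprn_gt0.
have uh : z ^+ 2 <= 1 / 4.
  have : z * z <= 1 / 2 * (1 / 2) by apply: ler_pM => //; exact: ltW.
  by rewrite expr2; lra.
pose x : R := z ^- 2 / 2.
have x2 : 2 <= x.
  have : (1 / 4)^-1 <= (z ^+ 2)^-1 by rewrite lef_pV2 ?posrE.
  by rewrite /x; lra.
have x0 : 0 <= x by lra.
pose k' := Num.truncn x.
have /andP[kx xk] : (k'%:R <= x < k'.+1%:R) by exact: truncn_itv.
rewrite -natr1 in xk.
have k0 : (0 < k')%N by rewrite -(ltr_nat R); lra.
have k2 : z ^+ 2 * (k'.*2)%:R <= 1.
  rewrite -mul2n natrM mulrC -ler_pdivlMr// div1r; move: kx; rewrite /x; lra.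
have kR : 0 < (k'.*2)%:R :> R by rewrite ltr0n double_gt0.
(* The exponent 0.49 enters here: [2k'] is at most n^0.98 / 4, which leaves at least n^0.02 for the
   levels. *)
have lnk : ln (k'.*2)%:R <= 98 / 100 * ln n%:R - 2 * ln 2 :> R.
  have : ln (k'.*2)%:R <= ln (z ^- 2) :> R.
    rewrite ler_ln ?posrE ?invr_gt0//.
    by rewrite -[leRHS]mul1r ler_pdivlMr// mulrC.
  rewrite lnV ?posrE// lnXn// mulr2n.
  have : ln (2 * eps) <= ln z by rewrite ler_ln ?posrE ?mulr_gt0//; lra.
  rewrite lnM ?posrE//.
  have := ln_eps; lra.
have kn : ((k'.*2) <= n)%N.
  rewrite -(ler_nat R) -ler_ln ?posrE//.
  have := ln_n_ge1; have := ln2_ge; lra.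
pose m := (n %/ k'.*2)%N.
have m0 : (0 < m)%N by rewrite divn_gt0 ?double_gt0.
pose L := trunc_log 2 m.
have /andP[Lm mL] : (2 ^ L <= m < 2 ^ L.+1)%N by exact: trunc_log_bounds.
have lnL : 2 / 100 * ln n%:R + ln 2 <= L%:R * ln 2 :> R.
  have : ln n%:R <= ln ((k'.*2)%:R * (2 ^ L.+1)%:R) :> R.
    rewrite -natrM ler_ln ?posrE ?ltr0n ?muln_gt0 ?double_gt0 ?k0 ?expn_gt0// ler_nat.
    have k2gt0 : (0 < k'.*2)%N by rewrite double_gt0.
    apply: leq_trans (ltnW (ltn_ceil n k2gt0)) _.
    by rewrite mulnC leq_mul2l mL orbT.
  have p0 : 0 < (2 : R) ^+ L.+1 by rewrite exprn_gt0.
  rewrite natrX (lnM kR p0) (lnXn _ (ltr0Sn R 1)) -[ln 2 *+ _]mulr_natr -natr1; lra.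
have Lge : 2 / 100 * ln n%:R <= L%:R :> R.
  have := ln2_le; have := ln2_ge; have := ln_n_ge1 => l1 l2 l3.
  have : L%:R * ln 2 <= L%:R * 1 :> R by rewrite ler_wpM2l.
  lra.
have L0 : (0 < L)%N by rewrite -(ltr_nat R); have := ln_n_ge1; lra.
exists k', L; split => //.
  by apply: leq_trans (leq_trunc_div n k'.*2); rewrite mulnC leq_mul2r Lm orbT.
have kE : eps ^- 2 <= (1000 * 1000) * k'%:R.
  have : x <= 2 * k'%:R by move: x2 xk; lra.
  have xE : x * (z * z) = 1 / 2.
    by rewrite /x expr2; field; rewrite gt_eqF.
  have eE : eps ^- 2 * (eps * eps) = 1.
    by rewrite expr2 mulVf// mulf_neq0// gt_eqF.
  have -> : eps ^- 2 = x * (1000 * 500).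
    apply: (mulIf (x := eps * eps)); first by rewrite mulf_neq0// gt_eqF.
    rewrite eE; move: xE; rewrite zE; lra.
  lra.
rewrite natrM; have -> : (1000 * 1000 * 50) * (L%:R * k'%:R) = ((1000 * 1000) * k'%:R) * (50 * L%:R) :> R.
  by ring.
apply: ler_pM => //.
- by rewrite invr_ge0 exprn_ge0// ltW.
- by have := ln_n_ge1; lra.
- lra.
Qed.

End GridParameters.

Lemma stream_length_le (a M r n : nat) : (0 < a)%N -> (0 < M)%N -> (0 < r)%N ->
  ((a ^ 2 * M ^ 3 * (M + r + r.*2 + a * r) + (a ^ 2 * M ^ 3 * (M + r + r.*2 + a * r) + r)) * n
    <= 11 * (a ^ 3 * M ^ 4 * r * n))%N.
Proof.
move=> a0 M0 r0.
have step : (M + r + r.*2 + a * r <= 5 * (a * M * r))%N.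
  have h1 : (M <= a * M * r)%N by rewrite -{1}[M]mul1n -{1}[(1 * M)%N]muln1 !leq_mul.
  have h2 : (r <= a * M * r)%N by rewrite -{1}[r]mul1n leq_mul// muln_gt0 a0.
  have h3 : (a * r <= a * M * r)%N by rewrite leq_mul// -{1}[a]muln1 leq_mul.
  lia.
have h4 : (r <= a ^ 3 * M ^ 4 * r)%N by rewrite -{1}[r]mul1n leq_mul// muln_gt0 !expn_gt0 a0 M0.
rewrite mulnA leq_mul//.
have h5 : (a ^ 2 * M ^ 3 * (M + r + r.*2 + a * r) <= 5 * (a ^ 3 * M ^ 4 * r))%N.
  apply: leq_trans (leq_mul (leqnn _) step) _.
  by rewrite [(a ^ 3)%N]expnSr [(M ^ 4)%N]expnSr; apply: eq_leq; ring.
lia.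
Qed.

(** * Choice of [Lm] and the final estimates *)

Section LowerBounds.
Context {R : realType} {n W : nat} {eps C0 : R}.
Hypotheses (n_gt0 : (0 < n)%N) (eps_low : n%:R `^ (- (49 / 100)) <= eps) (eps_up : eps <= 1 / 1000).
Hypotheses (C0_ge : 1001 <= C0) (lnC0 : ln C0 = 1000) (nW : n%:R `^ C0 <= W%:R).
Context {d : measure_display} {Seed : measurableType d} {P : probability Seed R}.
Context {A : Seed -> det_algorithm R n} {S : nat}.
Hypotheses (HA : approximates_L0 P A eps W) (HS : uses_space A S).

Let K : R := eps ^- 2 * ln n%:R.
Let w : R := ln W%:R.
Let D : R := 1000 * 1000 * 50 * (1000 * 60).

Let n0 : 0 < n%:R :> R. Proof. by rewrite ltr0n. Qed.

Let W0 : 0 < W%:R :> R.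
Proof. exact: lt_le_trans (powR_gt0 _ n0) nW. Qed.

Let lnn : 1 <= ln n%:R :> R.
Proof. exact: ln_n_ge1 n_gt0 eps_low eps_up. Qed.

Let e0 : 0 < eps. Proof. exact: eps_gt0 n_gt0 eps_low. Qed.

Lemma lnW_ge : C0 * ln n%:R <= w.
Proof. exact: ln_le_powR. Qed.

Lemma C0_le_lnW : C0 <= w.
Proof.
have C1 : 0 <= C0 by move: C0_ge; lra.
by apply: le_trans lnW_ge; rewrite -{1}[C0]mulr1 ler_wpM2l.
Qed.

Lemma lnn_le_lnW : 1001 * ln n%:R <= w.
Proof. by apply: le_trans lnW_ge; rewrite ler_wpM2r//; move: lnn; lra. Qed.

Let w_ge : 1001 <= w.
Proof. exact: le_trans C0_ge C0_le_lnW. Qed.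

Lemma lnlnW_ge : 1000 <= ln w.
Proof.
have C1 : 0 < C0 by move: C0_ge; lra.
rewrite -lnC0 ler_ln ?posrE//; last by move: w_ge; lra.
exact: C0_le_lnW.
Qed.

Lemma lnK_ge1 : 1 <= ln K.
Proof.
have l0 : 0 < ln n%:R :> R by move: lnn; lra.
have e2 : 0 < eps ^- 2 by rewrite invr_gt0 exprn_gt0.
have : ln (eps ^- 2) <= ln K.
  by rewrite ler_ln ?posrE ?mulr_gt0//; rewrite -{1}[eps ^- 2]mulr1 ler_wpM2l// ltW.
rewrite lnV ?posrE ?exprn_gt0// lnXn// mulr2n.
by have := ln_le_subr1 e0; move: eps_up; lra.
Qed.

Let K_gt0 : 0 < K.
Proof. by rewrite mulr_gt0 ?invr_gt0 ?exprn_gt0//; move: lnn; lra. Qed.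

Lemma four_le_W : (4 * n <= W)%N.
Proof.
rewrite -(ler_nat R) natrM -ler_ln ?posrE ?mulr_gt0// lnM ?posrE//.
have -> : 4 = 2 * 2 :> R by ring.
rewrite lnM ?posrE//; have := @ln2_le R; have := lnn_le_lnW; move: lnn; rewrite -/w; lra.
Qed.

Lemma space_linear : K <= D * S%:R.
Proof.
have [k' [L [k0 L0 kL ek KL]]] := grid_parameters n_gt0 eps_low eps_up.
have [emb emb_inj] := block_embedding kL.
have k20 : (0 < k'.*2)%N by rewrite double_gt0.
have := short_stream_bound emb_inj HA HS L0 k20 (ltW e0) ek four_le_W.
have -> : (L * k'.*2)%:R = (L * k')%:R * 2 :> R by rewrite -natrM -muln2 mulnA.
move: KL; rewrite -/K /D; set X := (L * k')%:R; lra.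
Qed.

Lemma space_long_stream (Lm a : nat) : (0 < Lm)%N -> 8 <= ln Lm%:R :> R ->
  1000 * 1000 <= a%:R :> R ->
  (11 * (a ^ 3 * (2 ^ S) ^ 4 * Lm`! * n) <= W)%N ->
  K * ln Lm%:R <= D * S%:R.
Proof.
move=> Lm0 lnLm aR lenW.
have [k' [L [k0 L0 kL ek KL]]] := grid_parameters n_gt0 eps_low eps_up.
have [emb emb_inj] := block_embedding kL.
have a0 : (0 < a)%N by rewrite -(ltr_nat R); move: aR; lra.
have M0 : (0 < 2 ^ S)%N by rewrite expn_gt0.
have lenW' := leq_trans (stream_length_le n a0 M0 (fact_gt0 Lm)) lenW.
have h1 := long_stream_bound emb_inj HA HS L0 k0 Lm0 (ltW e0) ek lnLm aR lenW'.
have y0 : 0 <= ln Lm%:R :> R by move: lnLm; lra.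
have h2 := ler_wpM2r y0 KL.
rewrite -[1000 * 1000 * 50 * _ * _]mulrA in h2.
move: h1 h2; rewrite -/K; set Z := _ * ln _; set V := K * _; rewrite /D; lra.
Qed.

Lemma large_base : exists2 a : nat, 1000 * 1000 <= a%:R :> R & ln a%:R <= 20 :> R.
Proof.
exists (2 ^ 20)%N; rewrite natrX.
  by rewrite !exprS expr0; lra.
by rewrite lnXn// -[ln 2 *+ _]mulr_natr; have := @ln2_le R; lra.
Qed.

(** If K <= sqrt w use ln x <= x; otherwise ln w < 2 ln K, and the assumption gives K ln K <= w. *)
Lemma K_lnlnW_le : K `^ (C0 * K) <= W%:R -> K * ln w <= 2 * w.
Proof.
move=> /(ln_le_powR K_gt0 W0); rewrite -/w => KW.
have w0 : 0 < w by move: w_ge; lra.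
pose s := Num.sqrt w.
have s0 : 0 < s by rewrite sqrtr_gt0.
have ss : s * s = w by rewrite -expr2 sqr_sqrtr// ltW.
have lnw : ln w = 2 * ln s by rewrite -ss lnM ?posrE//; lra.
have [Ks|sK] := leP K s.
  have : K * ln w <= s * (2 * s).
    apply: ler_pM => //; [exact: ltW | by have := lnlnW_ge; lra | ].
    by rewrite lnw; have := ln_le_subr1 s0; lra.
  by rewrite -ss; lra.
have : K * ln s <= K * ln K by rewrite ler_wpM2l ?(ltW K_gt0)// ler_ln ?posrE// ltW.
have : 1 * (K * ln K) <= C0 * (K * ln K).
  rewrite ler_wpM2r//; last by move: C0_ge; lra.
  by rewrite mulr_ge0 ?(ltW K_gt0)//; have := lnK_ge1; lra.
by rewrite lnw; move: KW; lra.
Qed.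

                                                                                
                                                                       
(** Argue by contradiction: a small S is at most a small multiple of w = ln W, so the factor 2^(4S)
    in the stream length is affordable. *)
Lemma space_very_long : K `^ (C0 * K) <= W%:R -> K * ln w <= 8 * D * S%:R.
Proof.
move=> /K_lnlnW_le KW; rewrite leNgt; apply/negP => Ssmall.
have w0 : 0 < w by move: w_ge; lra.
(* With [Lm] about w^(1/4), [Lm!] is at most exp (sqrt w), well below W, while ln [Lm] is still at
   least ln w / 8. *)
pose s := Num.sqrt w; pose q := Num.sqrt s.
have s0 : 0 < s by rewrite sqrtr_gt0.
have q0 : 0 < q by rewrite sqrtr_gt0.
have ss : s * s = w by rewrite -expr2 sqr_sqrtr// ltW.
have qq : q * q = s by rewrite -expr2 sqr_sqrtr// ltW.
have lnw : ln w = 4 * ln q by rewrite -ss -qq !lnM ?posrE ?mulr_gt0//; lra.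
have lnq : 250 <= ln q by have := lnlnW_ge; lra.
have q_ge : 250 <= q by have := ln_le_subr1 q0; lra.
have s8 : 8 <= s.
  have : 4 * 4 <= q * q by apply: ler_pM => //; lra.
  lra.
have sw : 8 * s <= w by rewrite -ss ler_wpM2r// ltW.
pose Lm := Num.truncn q.
have /andP[Lq qL] : (Lm%:R <= q < Lm.+1%:R) by apply: truncn_itv; exact: ltW.
rewrite -natr1 in qL.
have Lm0 : (0 < Lm)%N by rewrite -(ltr_nat R); lra.
have LmR : 0 < Lm%:R :> R by rewrite ltr0n.
have lnLm : ln q / 2 <= ln Lm%:R :> R.
  have : ln q <= ln (2 * Lm%:R) by rewrite ler_ln ?posrE ?mulr_gt0//; lra.
  by rewrite lnM ?posrE//; have := @ln2_le R; lra.
have fL : (Lm`!)%:R <= expR s :> R.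
  by apply: fact_le_expR; rewrite expr2 -qq; apply: ler_pM.
have lnf : ln (Lm`!)%:R <= s :> R.
  by rewrite -[s]expRK ler_ln ?posrE ?expR_gt0// ltr0n fact_gt0.
have [a aR lna] := large_base.
have a0 : 0 < a%:R :> R by move: aR; lra.
have lenW : (11 * (a ^ 3 * (2 ^ S) ^ 4 * Lm`! * n) <= W)%N.
  have f0 : 0 < (Lm`!)%:R :> R by rewrite ltr0n fact_gt0.
  have p0 : 0 < (2 : R) ^+ S by rewrite exprn_gt0.
  rewrite -(ler_nat R) !natrM !natrX -ler_ln ?posrE ?mulr_gt0 ?exprn_gt0//.
  rewrite !lnM ?posrE ?mulr_gt0 ?exprn_gt0// !lnXn ?exprn_gt0//.
  rewrite -[ln 2 *+ S]mulr_natr.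
  have l11 : ln 11 <= 10 :> R by have := @ln_le_subr1 R 11 (ltr0Sn _ _); lra.
  have l2S : ln 2 * S%:R <= 1 * S%:R :> R by rewrite ler_wpM2r// ln2_le.
  have := lnn_le_lnW; have : 0 <= S%:R :> R by [].
  move: Ssmall w_ge; rewrite -/w /D; lra.
have lnL8 : 8 <= ln Lm%:R :> R by lra.
have := space_long_stream Lm0 lnL8 aR lenW.
have : K * (ln w / 8) <= K * ln Lm%:R by rewrite ler_wpM2l ?(ltW K_gt0)//; lra.
by move: Ssmall; lra.
Qed.

(** If W is not huge, then w <= C0 K ln K, so ln w is at most a constant times ln (K ln w), and
    [space_linear] suffices; otherwise [space_very_long] is even stronger. *)
Lemma space_general : K * ln w / ln (K * ln w) <= 1002 * D * S%:R.
Proof.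
have lw := lnlnW_ge; have lK := lnK_ge1.
have w0 : 0 < w by move: w_ge; lra.
have lw0 : 0 < ln w by lra.
have lnx : ln K <= ln (K * ln w).
  rewrite lnM ?posrE//; have : ln 1 <= ln (ln w) by rewrite ler_ln ?posrE//; lra.
  by rewrite ln1; lra.
have lnx0 : 0 < ln (K * ln w) by lra.
have D0 : 0 <= D * S%:R by rewrite mulr_ge0// /D; lra.
rewrite ler_pdivrMr//.
have [/space_very_long h|/ltW hW] := leP (K `^ (C0 * K)) W%:R.
  have : 1002 * D * S%:R * 1 <= 1002 * D * S%:R * ln (K * ln w).
    by apply: ler_wpM2l; lra.
  lra.
have C1 : 0 < C0 by move: C0_ge; lra.
have KlK : 0 < ln K by lra.
have wK : w <= C0 * K * ln K.
  by rewrite -ln_powR ler_ln ?posrE ?powR_gt0.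
have : ln w <= 1000 + ln K + ln (ln K).
  rewrite -lnC0 -(lnM C1 K_gt0) -(lnM (mulr_gt0 C1 K_gt0) KlK) ler_ln ?posrE//.
  exact: mulr_gt0 (mulr_gt0 C1 K_gt0) KlK.
have := ln_le_subr1 KlK => h1 h2.
have : K * ln w <= K * (1002 * ln (K * ln w)).
  by rewrite ler_wpM2l ?(ltW K_gt0)//; lra.
have : K * (1002 * ln (K * ln w)) <= D * S%:R * (1002 * ln (K * ln w)).
  by apply: (ler_wpM2r _ space_linear); lra.
lra.
Qed.

End LowerBounds.

Theorem theorem7p2p2 (R : realType) :
  exists c0 C0 c1 c2 : R,
    [/\ 0 < c0, 0 < C0, 0 < c1 & 0 < c2] /\
    forall (n W : nat) (eps : R),
      (0 < n)%N ->
      n%:R `^ (- (49 / 100)) <= eps -> eps <= c0 ->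
      n%:R `^ C0 <= W%:R ->
      forall (d : measure_display) (Seed : measurableType d)
        (P : probability Seed R) (A : Seed -> det_algorithm R n) (S : nat),
        approximates_L0 P A eps W ->
        uses_space A S ->
        c1 * (eps ^- 2 * ln n%:R * ln (ln W%:R)
              / ln (eps ^- 2 * ln n%:R * ln (ln W%:R))) <= S%:R
        /\
        ((eps ^- 2 * ln n%:R) `^ (C0 * (eps ^- 2 * ln n%:R)) <= W%:R ->
         c2 * (eps ^- 2 * ln n%:R * ln (ln W%:R)) <= S%:R).
Proof.
pose D : R := 1000 * 1000 * 50 * (1000 * 60).
have D1 : 0 < 1002 * D by rewrite /D; lra.
have D2 : 0 < 8 * D by rewrite /D; lra.
(* C0 = exp 1000 makes ln ln W >= 1000, which absorbs the additive constants in the estimates. *)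
have [C0 C0_ge lnC0] : exists2 C0 : R, 1001 <= C0 & ln C0 = 1000.
  by exists (expR 1000); [have := expR_ge1Dx (1000 : R); lra | exact: expRK].
exists (1 / 1000), C0, (1002 * D)^-1, (8 * D)^-1; split.
  by split; [lra | lra | rewrite invr_gt0 | rewrite invr_gt0].
move=> n W eps n0 elow eup nW d Seed P A S HA HS; split.
  have := space_general n0 elow eup C0_ge lnC0 nW HA HS.
  by rewrite -/D ler_pdivrMl.
move=> KW; have := space_very_long n0 elow eup C0_ge lnC0 nW HA HS KW.
by rewrite -/D ler_pdivrMl.
Qed.
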